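(* Consider the setting in the context, and suppose $w_{\max}$ is not used but a number $\hat w_{\max}\ge w_{\max}$ is known. Define $\hat\Theta_T(\hat w_{\max})=\bigcap_{t=0}^{T-1}\{\hat\theta:\|x_{t+1}-\hat\theta z_t\|_\infty\le\hat w_{\max}\}$. Then for any integer $m>0$, any $\delta>0$ and any integer $T>m$, $$\mathbb P\Big(\mathrm{diam}(\hat\Theta_T(\hat w_{\max}))>\delta+a_5\sqrt{n_x}(\hat w_{\max}-w_{\max})\Big)\le \mathbb T_1+\mathbb T_2(\delta),$$ where $a_5=4/a_1$, $\mathbb T_1=544\,\frac{T}{m}\,n_z^{2.5}\log(a_2n_z)\,a_2^{n_z}\exp(-a_3m)$ and $\mathbb T_2(\delta)=544\,(n_xn_z)^{2.5}\log(a_4n_xn_z)\,a_4^{n_xn_z}\big(1-q_w(\frac{a_1\delta}{4\sqrt{n_x}})\big)^{\lceil T/m\rceil}$.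
   Context: Unknown linear system $x_{t+1}=A^*x_t+B^*u_t+w_t$ with $x_t\in\mathbb R^{n_x}$, $u_t\in\mathbb R^{n_u}$; $n_z=n_x+n_u$, $z_t=(x_t^\top,u_t^\top)^\top$, $\theta^*=(A^*,B^* )$, so $x_{t+1}=\theta^*z_t+w_t$. $\mathrm{diam}(\mathbb S)=\sup_{\theta,\theta'\in\mathbb S}\|\theta-\theta'\|_F$. Assumption A1: $\|w_t\|_\infty\le w_{\max}$ for all $t$; $w_t$ i.i.d., zero mean, positive definite covariance. Assumption A2: with $\mathcal F_t=\sigma(w_0,\dots,w_{t-1},z_0,\dots,z_t)$, $(z_t)$ is adapted and for some $\sigma_z>0$, $p_z\in(0,1]$: for every unit $\lambda\in\mathbb R^{n_z}$ and $t\ge0$, $\mathbb P(|\lambda^\top z_{t+1}|\ge\sigma_z\mid\mathcal F_t)\ge p_z$ a.s.; and $\|z_t\|_2\le b_z$ a.s. for all $t$. Assumption A3: $q_w:(0,\infty)\to(0,1]$ non-decreasing with $q_w(2w_{\max})=1$ and, for all $\epsilon>0$ and coordinates $j$, $\min(\mathbb P(w_t^j\le\epsilon-w_{\max}),\mathbb P(w_t^j\ge w_{\max}-\epsilon))\ge q_w(\epsilon)$. Constants: $a_1=\sigma_zp_z/4$, $a_2=64b_z^2/(\sigma_z^2p_z^2)$, $a_3=p_z^2/8$, $a_4=4b_z\sqrt{n_x}/a_1$.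
   Formalization: The formal theorem also assumes that each w_t is independent of F_t (causal control); without it the claim fails, e.g. for A*=B*=0, w_t i.i.d. ±1 and u_t=w_t, where the diameter is always at least 2. *)

(* Defs.v *)
From HB Require Import structures.
From mathcomp Require Import all_boot all_order all_algebra.
From mathcomp Require Import all_classical all_reals all_analysis.
Set Implicit Arguments. Unset Strict Implicit. Unset Printing Implicit Defensive.
Import Order.TTheory GRing.Theory Num.Theory.
Local Open Scope classical_set_scope.
Local Open Scope ring_scope.

Section Defs.
Context {d : measure_display} {Omega : measurableType d} {R : realType}.

Definition linf_norm n (v : 'cV[R]_n) : R := \big[Num.max/0]_(i < n) `|v i 0|.
Definition l2_norm n (v : 'cV[R]_n) : R := Num.sqrt (\sum_(i < n) v i 0 ^+ 2).
Definition frob_norm m n (A : 'M[R]_(m, n)) : R :=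
  Num.sqrt (\sum_(i < m) \sum_(j < n) A i j ^+ 2).

Definition diam m n (S : set 'M[R]_(m, n)) : \bar R :=
  ereal_sup [set (frob_norm (A - B))%:E | A in S & B in S].

Definition coord_events n (f : Omega -> 'cV[R]_n) : set (set Omega) :=
  [set A | exists (i : 'I_n) (B : set R),
     measurable B /\ A = (fun om => f om i 0) @^-1` B].

Definition sigma_rv n (f : Omega -> 'cV[R]_n) : set (set Omega) :=
  <<s coord_events f >>.

Definition random_vector n (f : Omega -> 'cV[R]_n) : Prop :=
  forall i : 'I_n, measurable_fun setT (fun om => f om i 0).

Definition filtration nx nz (w : nat -> Omega -> 'cV[R]_nx)
    (z : nat -> Omega -> 'cV[R]_nz) (t : nat) : set (set Omega) :=
  <<s [set A | (exists2 s, (s < t)%N & coord_events (w s) A)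
            \/ (exists2 s, (s <= t)%N & coord_events (z s) A)] >>.

Definition mutually_independent (P : probability Omega R)
    (G : nat -> set (set Omega)) : Prop :=
  forall (s : seq nat) (E : nat -> set Omega), uniq s ->
    (forall i, i \in s -> G i (E i)) ->
    P (\bigcap_(i in [set` s]) E i) = (\prod_(i <- s) P (E i))%E.

Definition independent_sigma (P : probability Omega R)
    (G1 G2 : set (set Omega)) : Prop :=
  forall A B, G1 A -> G2 B -> P (A `&` B) = (P A * P B)%E.

(* identical distribution of two random vectors: equal probabilities of all
   Borel rectangles (a pi-system generating the Borel sets of R^n) *)
Definition same_law n (P : probability Omega R) (f g : Omega -> 'cV[R]_n) :=
  forall B : 'I_n -> set R, (forall i, measurable (B i)) ->
    P [set om | forall i, B i (f om i 0)] = P [set om | forall i, B i (g om i 0)].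

Definition cov_mx n (P : probability Omega R) (f : Omega -> 'cV[R]_n) : 'M[R]_n :=
  \matrix_(i, j) fine ('E_P[(fun om =>
      (f om i 0 - fine 'E_P[(fun om' => f om' i 0)%R]) *
      (f om j 0 - fine 'E_P[(fun om' => f om' j 0)%R]))%R])%E.

Definition posdef_mx n (M : 'M[R]_n) : Prop :=
  forall v : 'cV[R]_n, v != 0 -> 0 < (v^T *m M *m v) 0 0.

End Defs.

Section Consts.
Context {R : realType}.
Local Open Scope ring_scope.

Definition a1 (sigz pz : R) : R := sigz * pz / 4.
Definition a2 (sigz pz bz : R) : R := 64 * bz ^+ 2 / (sigz ^+ 2 * pz ^+ 2).
Definition a3 (pz : R) : R := pz ^+ 2 / 8.
Definition a4 (nx : nat) (sigz pz bz : R) : R :=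
  4 * bz * Num.sqrt (nx%:R) / a1 sigz pz.
Definition a5 (sigz pz : R) : R := 4 / a1 sigz pz.

Definition bbT1 (nz T m : nat) (sigz pz bz : R) : R :=
  544 * (T%:R / m%:R) * (nz%:R `^ (5 / 2)) * ln (a2 sigz pz bz * nz%:R)
  * a2 sigz pz bz ^+ nz * expR (- (a3 pz * m%:R)).

Definition bbT2 (nx nz T m : nat) (sigz pz bz : R) (qw : R -> R) (delta : R) : R :=
  544 * ((nx * nz)%:R `^ (5 / 2)) * ln (a4 nx sigz pz bz * (nx * nz)%:R)
  * a4 nx sigz pz bz ^+ (nx * nz)
  * (1 - qw (a1 sigz pz * delta / (4 * Num.sqrt (nx%:R))))
      ^ (Num.ceil (T%:R / m%:R : R)).

End Consts.

Section System.
Context {d : measure_display} {Omega : measurableType d} {R : realType}.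
Local Open Scope ring_scope.
Local Open Scope classical_set_scope.

Definition zvec nx nu (x : nat -> Omega -> 'cV[R]_nx) (u : nat -> Omega -> 'cV[R]_nu)
  (t : nat) (om : Omega) : 'cV[R]_(nx + nu) := col_mx (x t om) (u t om).

Definition Theta_hat nx nu (x : nat -> Omega -> 'cV[R]_nx)
  (u : nat -> Omega -> 'cV[R]_nu) (T : nat) (what : R) (om : Omega)
  : set 'M[R]_(nx, nx + nu) :=
  \bigcap_(t in [set t : nat | (t < T)%N])
    [set th | linf_norm (x t.+1 om - th *m zvec x u t om) <= what].

End System.

(* Main.v *)
(* Cut 1, ..., T - 1 into K = ceil (T / m) windows of length l = m / 2 (integer
   division).  Fix a finite net of the unit ball of R^nz, nz = nx + nu.  By the
   small-ball condition a given net direction g is missed at level |g| sigz throughout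
   a window with probability at most (1 - pz)^l, and a union bound makes all directions
   excited in all windows, up to probability T1.  The rate pz / 2 per time step beats
   the a3 = pz^2 / 8 of the statement, which pays for the halved windows.  Then, for
   every point g of a net of the unit ball of nx * nz matrices and every row j, stop
   in each window at the first time when (g z_t)_j is large.  The noise is independent
   of the past, so with probability at least q_w its j-th coordinate is then near the
   end of [- wmax, wmax] that excludes every parameter at distance more than c / 2 from
   theta* in a direction close to g, where
   c = delta + a5 * sqrt nx * (what - wmax).  Missing this in all windows has probability
   at most (1 - q_w)^K, and a union bound gives T2.  Two parameters at distance
   more than c cannot both be within c / 2 of theta*. *)
Require Import Defs.
From HB Require Import structures.
From mathcomp Require Import all_boot all_order all_algebra.
From mathcomp Require Import all_classical all_reals all_analysis.
From mathcomp Require Import ring lra zify.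
Set Implicit Arguments. Unset Strict Implicit. Unset Printing Implicit Defensive.
Import Order.TTheory GRing.Theory Num.Theory.
Import numFieldNormedType.Exports.
Local Open Scope classical_set_scope.
Local Open Scope ring_scope.

(** * Nets of the unit ball *)

(** Raise [7 / 8 <= expR (- (1 / 8))] to the eighth power and use [3 * (7 / 8) ^+ 8 >= 1]. *)
Lemma expR1_le3 (R : realType) : expR 1 <= 3 :> R.
Proof.
have h1 : 7 / 8 <= expR (- (1 / 8)) :> R.
  by apply: le_trans (expR_ge1Dx _); lra.
have h8 : (7 / 8) ^+ 8 <= expR (- 1) :> R.
  have -> : - 1 = 8%:R * - (1 / 8) :> R by lra.
  by rewrite expRM_natl lerXn2r// nnegrE ?expR_ge0//; lra.
move: h8; rewrite expRN => h8.
have e0 := expR_gt0 (1 : R).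
have : (7 / 8) ^+ 8 * expR 1 <= 1 :> R.
  by rewrite -[leRHS](mulVf (lt0r_neq0 e0)) ler_wpM2r// ltW.
by rewrite !exprS expr0; lra.
Qed.

(** With truncated subtraction the exponent is the distance from [a] to [M]: the centre contributes
    1 and each side a geometric sum of at most [x / (1 - x)]. *)
Lemma sum_expr_dist_le (R : realFieldType) (x : R) (M : nat) : 0 <= x -> x < 1 ->
  \sum_(a < M + M.+1) x ^+ ((M - a) + (a - M)) <= 1 + 2 * x / (1 - x).
Proof.
move=> x0 x1.
have geom k : \sum_(i < k) x ^+ i.+1 <= x / (1 - x).
  rewrite ler_pdivlMr ?subr_gt0//; have : \sum_(i < k) x ^+ i.+1 * (1 - x) = x - x ^+ k.+1.
    elim: k => [|k IH]; first by rewrite big_ord0 expr1 subrr.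
    by rewrite big_ord_recr/= IH !exprS; ring.
  by rewrite mulr_suml => ->; rewrite lerBlDr lerDl exprn_ge0.
rewrite big_split_ord/=.
have -> : \sum_(i < M) x ^+ (M - i + (i - M)) = \sum_(i < M) x ^+ i.+1.
  rewrite (reindex_inj rev_ord_inj)/=; apply: eq_bigr => i _.
  by congr (_ ^+ _); have := ltn_ord i; lia.
rewrite big_ord_recl/=.
have -> : \sum_(i < M) x ^+ (M - (M + bump 0 i) + (M + bump 0 i - M)) = \sum_(i < M) x ^+ i.+1.
  by apply: eq_bigr => i _; congr (_ ^+ _); rewrite /bump; lia.
rewrite addn0 subnn addn0 expr0.
have := geom M; have -> : 2 * x / (1 - x) = x / (1 - x) + x / (1 - x) by ring.
by move: (\sum_(i < M) _) => S; lra.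
Qed.

(* The net consists of the points of a cubic grid; rounding puts every point of the
   ball at a grid point whose integer coordinates k satisfy \sum_i |k i| <= n / s, and
   such k are counted with the weights (1 + s) ^ (n / s - \sum_i |k i|) >= 1. *)
Lemma unit_ball_net (R : realType) (I : finType) (e : R) : 0 < e ->
  exists2 S : seq {ffun I -> R}, (size S)%:R <= (3 * (2 + e^-1)) ^+ #|I|
  & forall f : I -> R, \sum_i f i ^+ 2 <= 1 ->
    exists2 g, g \in S & \sum_i (f i - g i) ^+ 2 <= e ^+ 2.
Proof.
move=> e0; set n := #|I|.
have [n0|n_gt0] := posnP n.
  exists [:: [ffun=> 0]]; first by rewrite n0 expr0.
  move=> f _; exists [ffun=> 0]; first by rewrite mem_seq1.
  by rewrite big_pred0 ?sqr_ge0// => i; have /card0_eq/(_ i) := n0.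
pose t : R := Num.sqrt n%:R.
have t0 : 0 < t by rewrite sqrtr_gt0 ltr0n.
have tt : t * t = n%:R by rewrite -expr2 sqr_sqrtr// ler0n.
(* Rounding moves each of the [n = t * t] coordinates by at most [h / 2], hence the point by at most
   [e]. *)
pose h := 2 * e / t.
have h0 : 0 < h by rewrite divr_gt0// mulr_gt0.
(* Two identities fix [s]: [n / s = t / h + n / 2], which bounds the l1 norm of rounded points, and
   [1 + 2 / s = 2 + e^-1], the base of the count. *)
pose s := 2 * e / (1 + e).
have s0 : 0 < s by rewrite divr_gt0// ?mulr_gt0// addr_gt0.
(* Integer coordinates are shifted by [M] to become ordinals; rounding a coordinate in [[-1, 1]]
   gives at most [h^-1 + 1 / 2] in absolute value. *)
pose M := Num.bound (h^-1 + 1).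
have hM : h^-1 + 1 < M%:R by apply: archi_boundP; rewrite addr_ge0// invr_ge0 ltW.
pose D (k : {ffun I -> 'I_(M + M.+1)}) := (\sum_i ((M - k i) + (k i - M)))%N.
pose pt (k : {ffun I -> 'I_(M + M.+1)}) := [ffun i => h * ((k i)%:R - M%:R)] : {ffun I -> R}.
exists [seq pt k | k <- enum [pred k | (D k)%:R <= n%:R / s]].
  rewrite size_map -cardE.
  pose x := (1 + s)^-1.
  have s1 : 0 < 1 + s by rewrite addr_gt0.
  have x0 : 0 < x by rewrite invr_gt0.
  (* [(1 + s) ^+ D k <= expR (s * D k) <= expR n <= 3 ^+ n]. *)
  have wt k : (D k)%:R <= n%:R / s -> 1 <= 3 ^+ n * x ^+ D k.
    move=> Dk; rewrite exprVn -ler_pdivrMr ?mul1r ?invrK; last by rewrite invr_gt0 exprn_gt0.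
    apply: (@le_trans _ _ (expR 1 ^+ n)); last first.
      by rewrite lerXn2r ?nnegrE ?expR_ge0// expR1_le3.
    apply: (@le_trans _ _ (expR s ^+ D k)).
      by rewrite lerXn2r ?nnegrE ?expR_ge0 ?expR_ge1Dx// ltW.
    by rewrite -!expRM_natl mulr1 ler_expR -ler_pdivlMr.
  apply: (@le_trans _ _ (\sum_k 3 ^+ n * x ^+ D k)).
    rewrite -sum1_card natr_sum big_mkcond/=; apply: ler_sum => k _.
    case: ifPn => [|_]; first by rewrite inE; exact: wt.
    by rewrite mulr_ge0// exprn_ge0// ltW.
  rewrite -mulr_sumr exprMn ler_pM2l ?exprn_gt0//.
  (* The weight is a product over coordinates, so its sum over the whole grid is the [n]-th power of
     a one-dimensional sum. *)
  under eq_bigr do rewrite /D expr_sum.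
  rewrite -(bigA_distr_bigA (fun (i : I) (a : 'I_(M + M.+1)) => x ^+ ((M - a) + (a - M)))).
  rewrite big_const iter_mulr mulr1 -/n lerXn2r ?nnegrE//.
  - by apply: sumr_ge0 => a _; rewrite exprn_ge0// ltW.
  - by rewrite addr_ge0// invr_ge0 ltW.
  have x1 : x < 1 by rewrite invf_lt1// ltrDl.
  apply: le_trans (sum_expr_dist_le _ (ltW x0) x1) _.
  have -> : 1 - x = s * x by rewrite /x; field; rewrite lt0r_neq0.
  have -> : 1 + 2 * x / (s * x) = 1 + 2 / s by field; rewrite !lt0r_neq0.
  have -> : 1 + 2 / s = 2 + e^-1 by rewrite /s; field; rewrite !lt0r_neq0//; lra.
  exact: lexx.
move=> f f1.
have fi1 i : `|f i| <= 1.
  rewrite -(ler_pXn2r (n := 2)) ?nnegrE// expr1n real_normK ?num_real//.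
  apply: le_trans f1; rewrite (bigD1 i)//= lerDl sumr_ge0// => j _; exact: sqr_ge0.
pose k i : int := Num.floor (f i / h + 1 / 2).
have kP i : `|f i / h - (k i)%:~R| <= 1 / 2.
  have := floor_itv (f i / h + 1 / 2); rewrite -/(k i) intrD => /andP[k1 k2].
  by rewrite ler_norml; apply/andP; split; move: k1 k2; rewrite /=; lra.
have kM i : `|k i| <= M%:Z.
  rewrite -(ler_int R) intr_norm.
  apply: (@le_trans _ _ (`|f i / h| + 1 / 2)).
    have := ler_normD (f i / h) ((k i)%:~R - f i / h).
    rewrite addrCA subrr addr0 => /le_trans; apply; rewrite lerD2l distrC; exact: kP.
  rewrite -pmulrn ltW// (le_lt_trans _ hM)// normrM (gtr0_norm (x := h^-1)) ?invr_gt0//.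
  rewrite lerD//; last by lra.
  by rewrite ler_piMl// ltW// invr_gt0.
have kP2 i : (`|(k i + M%:Z)%R|%N < M + M.+1)%N by have := kM i; lia.
pose K := [ffun i => Ordinal (kP2 i)] : {ffun I -> 'I_(M + M.+1)}.
have h2 : 0 <= h / 2 by rewrite divr_ge0// ltW.
have KE i : (K i)%:R - M%:R = (k i)%:~R :> R.
  rewrite ffunE/= !pmulrn -intrB; congr (_%:~R); have := kM i; lia.
exists (pt K).
  apply: map_f; rewrite mem_enum inE /D natr_sum.
  (* AM-GM with weight [t]; summed over [i] it bounds the l1 norm of [f] by [t], the square root of
     [n]. *)
  have abs_f i : `|f i| <= (t * f i ^+ 2 + t^-1) / 2.
    have : 0 <= t * (`|f i| - t^-1) ^+ 2 by rewrite mulr_ge0 ?sqr_ge0// ltW.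
    have -> : t * (`|f i| - t^-1) ^+ 2 = t * `|f i| ^+ 2 + t^-1 - 2 * `|f i|.
      by field; rewrite lt0r_neq0.
    by rewrite real_normK ?num_real//; lra.
  apply: (@le_trans _ _ (\sum_i (((t * f i ^+ 2 + t^-1) / 2) / h + 1 / 2))).
    apply: ler_sum => i _.
    have -> : ((M - K i) + (K i - M))%:R = `|(k i)%:~R| :> R.
      rewrite -KE; case: (leqP M (K i)) => MK.
        have -> : (M - K i + (K i - M))%N = (K i - M)%N by lia.
        by rewrite natrB// ger0_norm// subr_ge0 ler_nat.
      have -> : (M - K i + (K i - M))%N = (M - K i)%N by lia.
      by rewrite natrB 1?ltnW// distrC ger0_norm// subr_ge0 ler_nat ltnW.
    have := ler_normD (f i / h) ((k i)%:~R - f i / h).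
    rewrite addrCA subrr addr0 => /le_trans; apply; rewrite lerD//; last by rewrite distrC.
    by rewrite normrM (gtr0_norm (x := h^-1)) ?invr_gt0// ler_wpM2r// ltW// invr_gt0.
  rewrite big_split/= -!mulr_suml big_split/= -mulr_sumr !sumr_const -/n.
  rewrite -(mulr_natr t^-1) -tt.
  have -> : t * t / s = (t * 1 + t^-1 * (t * t)) / 2 / h + t * t / 2.
    by rewrite /s /h; field; rewrite !lt0r_neq0//; lra.
  rewrite lerD2r; do 2!(apply: ler_wpM2r; first by rewrite invr_ge0 ltW).
  by rewrite lerD2r ler_wpM2l// ltW.
apply: (@le_trans _ _ (\sum_(i : I) (h / 2) ^+ 2)).
  apply: ler_sum => i _; rewrite ffunE KE.
  rewrite -real_normK ?num_real// lerXn2r ?nnegrE//.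
  have -> : f i - h * (k i)%:~R = h * (f i / h - (k i)%:~R) by field; rewrite lt0r_neq0.
  rewrite normrM (gtr0_norm h0); apply: ler_wpM2l; first exact: ltW.
  by have := kP i; rewrite mul1r.
rewrite sumr_const -/n -[leLHS]mulr_natr -tt.
have -> : (h / 2) ^+ 2 * (t * t) = e ^+ 2 by rewrite /h; field; rewrite lt0r_neq0.
exact: lexx.
Qed.

(** Cauchy-Schwarz: the squares of [B * u i - C * v i] sum to [B * (A * B - C ^+ 2)]; if [B = 0]
    then [v] vanishes. *)
Lemma norm_dot_le (R : realType) (I : finType) (u v : I -> R) (r s : R) :
  0 <= r -> 0 <= s -> \sum_i u i ^+ 2 <= r ^+ 2 -> \sum_i v i ^+ 2 <= s ^+ 2 ->
  `|\sum_i u i * v i| <= r * s.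
Proof.
move=> r0 s0 ur vs.
set A := \sum_i u i ^+ 2 in ur *; set B := \sum_i v i ^+ 2 in vs *.
set C := \sum_i u i * v i.
have A0 : 0 <= A by apply: sumr_ge0 => i _; exact: sqr_ge0.
have B0 : 0 <= B by apply: sumr_ge0 => i _; exact: sqr_ge0.
have CAB : C ^+ 2 <= A * B.
  have : 0 <= \sum_i (B * u i - C * v i) ^+ 2 by apply: sumr_ge0 => i _; exact: sqr_ge0.
  have -> : \sum_i (B * u i - C * v i) ^+ 2 = B * (A * B - C ^+ 2).
    transitivity (\sum_i (B ^+ 2 * u i ^+ 2 - 2 * B * C * (u i * v i) + C ^+ 2 * v i ^+ 2)).
      by apply: eq_bigr => i _; ring.
    by rewrite !big_split/= sumrN -!mulr_sumr -/A -/B -/C; ring.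
  have [B_eq0 _|B_neq0] := eqVneq B 0; last first.
    by rewrite pmulr_rge0 ?subr_ge0// lt0r B_neq0.
  have v0 i : v i = 0.
    move/eqP: B_eq0; rewrite psumr_eq0 => [/allP/(_ i)|j _]; last exact: sqr_ge0.
    by rewrite mem_index_enum sqrf_eq0 => /(_ isT)/eqP.
  by rewrite /C big1 ?expr0n ?mulr_ge0// => i _; rewrite v0 mulr0.
rewrite -(ler_pXn2r (n := 2)) ?nnegrE ?mulr_ge0// real_normK ?num_real//.
by apply: le_trans CAB _; rewrite exprMn ler_pM.
Qed.

(** * Adapted hits over windows *)

Section GeneratedSigmaAlgebra.
Context {d : measure_display} {T : measurableType d}.
Implicit Types (G : set (set T)) (A B : set T).

Lemma gen_set0 G : <<s G >> set0.
Proof. exact: (@measurable0 _ (g_sigma_algebraType G)). Qed.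

Lemma gen_setT G : <<s G >> setT.
Proof. exact: (@measurableT _ (g_sigma_algebraType G)). Qed.

Lemma gen_setI G A B : <<s G >> A -> <<s G >> B -> <<s G >> (A `&` B).
Proof. exact: (@measurableI _ (g_sigma_algebraType G)). Qed.

Lemma gen_setU G A B : <<s G >> A -> <<s G >> B -> <<s G >> (A `|` B).
Proof. exact: (@measurableU _ (g_sigma_algebraType G)). Qed.

Lemma gen_setC G A : <<s G >> A -> <<s G >> (~` A).
Proof. exact: (@measurableC _ (g_sigma_algebraType G)). Qed.

End GeneratedSigmaAlgebra.

Lemma gen_measurable d (T : measurableType d) (G : set (set T)) A :
  G `<=` measurable -> <<s G >> A -> measurable A.
Proof.
by move=> Gm; apply: smallest_sub => //; exact: sigma_algebra_measurable.
Qed.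

Section FirstHit.
Context {d : measure_display} {T : measurableType d} {R : realType}.
Variables (P : probability T R) (G : nat -> set (set T)).
Hypothesis G_measurable : forall t, G t `<=` measurable.
Hypothesis G_mono : forall s t, (s <= t)%N -> G s `<=` G t.
Variable (H : nat -> set T).

Let Gm t A : <<s G t >> A -> measurable A.
Proof. exact: gen_measurable. Qed.

Let G_homo s t A : (s <= t)%N -> <<s G s >> A -> <<s G t >> A.
Proof. by move=> /G_mono st; apply: sub_sigma_algebra2. Qed.

Hypothesis H_adapted : forall t, <<s G t >> (H t).

(** The window is [a + 1, ..., a + l]; the recursion peels off its last time, which is then
    conditioned on all earlier ones. *)
Fixpoint no_hit (a l : nat) : set T :=
  if l is k.+1 then no_hit a k `&` ~` H (a + k).+1 else setT.

Lemma no_hitP a l om :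
  ~ no_hit a l om -> exists2 s, (a < s <= a + l)%N & H s om.
Proof.
elim: l => [|l IH] /=; first by move=> /(_ I).
move=> /not_andP[/IH[s sal Hs]|/contrapT Hs].
  by exists s => //; lia.
by exists (a + l).+1 => //; lia.
Qed.

Lemma no_hit_adapted a l : <<s G (a + l) >> (no_hit a l).
Proof.
elim: l => [|l IH]/=; first exact: gen_setT.
apply: gen_setI; first by apply: G_homo IH; lia.
by apply: gen_setC; rewrite addnS; exact: H_adapted.
Qed.

Lemma measurable_no_hit a l : measurable (no_hit a l).
Proof. exact: Gm (@no_hit_adapted a l). Qed.

(** The hypothesis is the conditional bound integrated over past events. Applied to the event of no
    hit so far, it gains a factor [1 - p] per step. *)
Lemma probability_no_hit_le (p : R) a l : p <= 1 ->
  (forall t A, <<s G t >> A -> (p%:E * P A <= P (A `&` H t.+1))%E) ->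
  (P (no_hit a l) <= ((1 - p) ^+ l)%:E)%E.
Proof.
move=> p1 hp; elim: l => [|l IH]/=; first by rewrite probability_setT.
have mN := measurable_no_hit a l; have mH := Gm (@H_adapted (a + l).+1).
rewrite -setDE.
have real_prob A : measurable A -> exists q, P A = q%:E.
  by move=> mA; exists (fine (P A)); rewrite fineK//; exact: fin_num_measure.
have : (p%:E * P (no_hit a l) <= P (no_hit a l `&` H (a + l).+1))%E.
  exact: hp (@no_hit_adapted a l).
have : (P (no_hit a l) = P (no_hit a l `\` H (a + l).+1)
                       + P (no_hit a l `&` H (a + l).+1))%E.
  exact: measureDI.
have [n nE] := real_prob _ mN; have [i iE] := real_prob _ (measurableI _ _ mN mH).
have [e eE] := real_prob _ (measurableD mN mH).
move: IH; rewrite iE eE nE -EFinD -EFinM !lee_fin => IH -[ne] pn.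
rewrite exprS; apply: (@le_trans _ _ ((1 - p) * n)); first by move: ne pn; lra.
by rewrite ler_wpM2l// subr_ge0.
Qed.

Variable (M : nat -> set T).

(** The argument [A] accumulates the absence of hits before [a], so [M] is only tested up to and
    including the first hit. *)
Fixpoint first_bad (a l : nat) (A : set T) : set T :=
  if l is k.+1 then (A `&` M a) `|` first_bad a.+1 k (A `&` ~` H a) else set0.

(** Window [j] is [j * l + 1, ..., j * l + l], the same as that of [no_hit (j * l) l]. *)
Fixpoint all_bad (l k : nat) : set T :=
  if k is j.+1 then first_bad (1 + j * l) l (all_bad l j) else setT.

Lemma first_badP a l A om s : A om -> (a <= s < a + l)%N -> H s om ->
  (forall s, (a <= s < a + l)%N -> H s om -> M s om) -> first_bad a l A om.
Proof.
elim: l a A => [|l IH] a A Aom sal Hs HM /=; first by lia.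
have [Ha|nHa] := pselect (H a om).
  by left; split => //; apply: HM => //; lia.
right; apply: IH => //; last by move=> t tal; apply: HM; lia.
have : s != a by apply: contra_notN nHa => /eqP <-.
by lia.
Qed.

Lemma all_badP l k om :
  (forall j, (j < k)%N -> exists2 s, (j * l < s <= j * l + l)%N & H s om) ->
  (forall s, (0 < s <= k * l)%N -> H s om -> M s om) -> all_bad l k om.
Proof.
elim: k => [//|k IH] hit HM /=.
have [s sk Hs] := hit k (ltnSn k).
apply: (first_badP (s := s)) => //; last by move=> t tk; apply: HM; rewrite mulSn; lia.
apply: IH => [j jk|t tk]; first by apply: hit; lia.
by apply: HM; rewrite mulSn; lia.
Qed.

Hypothesis M_adapted : forall t, <<s G t.+1 >> (M t).

(** The last time tested is [a + l - 1], and [M] at that time is known one step later, hence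
    [G (a + l)]. *)
Lemma first_bad_adapted a l A :
  <<s G a >> A -> <<s G (a + l) >> (first_bad a l A).
Proof.
elim: l a A => [|l IH] a A GA /=; first exact: gen_set0.
apply: gen_setU.
  apply: (@G_homo a.+1); first by lia.
  by apply: gen_setI => //; apply: G_homo GA; lia.
rewrite -addSnnS; apply: IH; apply: (@G_homo a); first by lia.
by apply: gen_setI => //; apply: gen_setC; exact: H_adapted.
Qed.

Lemma all_bad_adapted l k : <<s G (1 + k * l) >> (all_bad l k).
Proof.
elim: k => [|k IH]/=; first exact: gen_setT.
apply: (@G_homo (1 + k * l + l)); first by rewrite mulSn; lia.
exact: first_bad_adapted.
Qed.

Lemma measurable_all_bad l k : measurable (all_bad l k).
Proof. exact: Gm (@all_bad_adapted l k). Qed.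

Variable r : R.
Hypothesis r0 : 0 <= r.
Hypothesis M_le : forall t A, <<s G t >> A -> (P (A `&` M t) <= r%:E * P (A `&` H t))%E.

(** The factor [r] is paid once per window and not once per time: the parts of [A] on which the
    first hit occurs at different times are disjoint, so their probabilities add up to at most that
    of [A]. *)
Lemma probability_first_bad_le a l A : <<s G a >> A ->
  (P (first_bad a l A) <= r%:E * P A)%E.
Proof.
elim: l a A => [|l IH] a A GA /=; first by rewrite measure0 mule_ge0// lee_fin.
have GAH : <<s G a >> (A `&` ~` H a).
  by apply: gen_setI => //; apply: gen_setC; exact: H_adapted.
have GAM : <<s G a.+1 >> (A `&` M a).
  by apply: gen_setI => //; apply: G_homo GA; lia.
have GAH1 : <<s G a.+1 >> (A `&` ~` H a) by apply: G_homo GAH; lia.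
apply: le_trans (measureU2 _ (Gm GAM) (Gm (@first_bad_adapted _ l _ GAH1))) _.
apply: le_trans (leeD (M_le GA) (IH _ _ GAH1)) _.
rewrite -muleDr// ?ge0_adde_def ?inE//.
by rewrite -setDE [X in (_ <= _ * X)%E](measureDI P (Gm GA) (Gm (@H_adapted a))) addeC.
Qed.

(** The outcome of the first [k] windows belongs to the past of the next window, so the factors [r]
    multiply. *)
Lemma probability_all_bad_le l k : (P (all_bad l k) <= (r ^+ k)%:E)%E.
Proof.
elim: k => [|k IH]/=; first by rewrite probability_setT.
apply: le_trans (probability_first_bad_le _ (@all_bad_adapted l k)) _.
by rewrite exprS EFinM lee_wpmul2l.
Qed.

End FirstHit.

(** * Measurability of the diameter event *)

Section BigMax.
Context {R : realType} {I : Type}.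

Lemma continuous_bigmax (T : topologicalType) (s : seq I) (b : R) (f : I -> T -> R) :
  (forall i, continuous (f i)) -> continuous (fun v => \big[Num.max/b]_(i <- s) f i v).
Proof.
move=> fc; elim: s => [|i s IH] v.
  by under eq_fun do rewrite big_nil; exact: cvg_cst.
under eq_fun do rewrite big_cons.
by apply: continuous_max; [exact: fc|exact: IH].
Qed.

Lemma continuous_bigsum (T : topologicalType) (s : seq I) (f : I -> T -> R) :
  (forall i, continuous (f i)) -> continuous (fun v => \sum_(i <- s) f i v).
Proof.
move=> fc; elim: s => [|i s IH] v.
  by under eq_fun do rewrite big_nil; exact: cvg_cst.
under eq_fun do rewrite big_cons.
by apply: continuousD; [exact: fc|exact: IH].
Qed.

Lemma measurable_bigmax d (T : measurableType d) (s : seq I) (b : R) (f : I -> T -> R) :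
  (forall i, measurable_fun setT (f i)) ->
  measurable_fun setT (fun v => \big[Num.max/b]_(i <- s) f i v).
Proof.
move=> fm; elim: s => [|i s IH].
  by under eq_fun do rewrite big_nil; exact: measurable_cst.
under eq_fun do rewrite big_cons.
exact: measurable_realfun.measurable_maxr.
Qed.

End BigMax.

Lemma measurable_lt_cst d (T : measurableType d) (R : realType) (f : T -> R) (c : R) :
  measurable_fun setT f -> measurable [set t | f t < c].
Proof.
move=> fm; have := measurable_realfun.measurable_fun_ltr fm (measurable_cst c).
by move=> /(_ measurableT [set true] I); rewrite setTI.
Qed.

Lemma measurable_cst_le d (T : measurableType d) (R : realType) (f : T -> R) (c : R) :
  measurable_fun setT f -> measurable [set t | c <= f t].
Proof.
move=> fm; have := measurable_realfun.measurable_fun_ler (measurable_cst c) fm.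
by move=> /(_ measurableT [set true] I); rewrite setTI.
Qed.

(* The coercivity of G keeps approximate solutions in a compact box, so that a point
   with G v <= 0 exists iff there are rational points with arbitrarily small G. *)
Lemma measurable_exists_le0 d (T : measurableType d) (R : realType) (n : nat)
    (G : 'rV[R]_n -> T -> R) (c : R) :
  (forall om, continuous (G^~ om)) -> (forall v, measurable_fun setT (G v)) ->
  (forall (v : 'rV[R]_n) om i, `|v 0 i| - c <= G v om) ->
  measurable [set om | exists v, G v om <= 0].
Proof.
move=> Gc Gm Gcoer.
rewrite (_ : [set _ | _] = \bigcap_(j : nat) \bigcup_(q : 'rV[rat]_n)
    [set om | G (map_mx ratr q) om < j.+1%:R^-1]).
  apply: bigcapT_measurable => j; apply: countable_bigcupT_measurable => // q.
  exact: measurable_lt_cst.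
apply/seteqP; split => om /=.
  move=> [v Gv] j _.
  have /(Gc om v) : nbhs (G v om) [set x : R | x < j.+1%:R^-1].
    apply: open_nbhs_nbhs; split; first exact: open_lt.
    by apply: le_lt_trans Gv _; rewrite invr_gt0.
  rewrite nbhs_simpl/= => /nbhs_ballP[e /= e0 ve].
  have /choice[q qP] : forall i, exists q : rat, ball (v 0 i) e (ratr q : R).
    move=> i; have [|q] := @rat_in_itvoo R (v 0 i - e) (v 0 i + e).
      by rewrite ltrD2l; lra.
    rewrite in_itv/= => qP; exists q; rewrite -ball_normE /= ltr_distlC.
    by move: qP; rewrite andbC => /andP[? ?]; apply/andP; split; lra.
  exists (\row_i q i) => //=; apply: ve; split=> // i k.
  by rewrite !mxE ord1; exact: qP.
move=> /(_ _ I) Gq.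
have qP j := cid (let: ex_intro2 q _ h := Gq j in ex_intro _ q h).
(* Values of [G] below [j.+1%:R^-1 <= 1] force coordinates of size at most [c + 1]. *)
pose K := [set v : 'rV[R]_n | forall i, v ord0 i \in `[- (c + 1), c + 1]].
have Kq j : K (map_mx ratr (projT1 (qP j))).
  move=> i; case: (qP j) => q /= Gqj; rewrite in_itv/= -ler_norml.
  have := Gcoer (map_mx ratr q) om i; rewrite lerBlDr => /le_trans; apply.
  by rewrite addrC lerD2l ltW// (lt_le_trans Gqj)// invf_le1// ler1n.
have Kc : compact K.
  exact: (@rV_compact R n (fun=> `[- (c + 1), c + 1]%classic) (fun=> @segment_compact R _ _)).
have [|v vK vmin] := compact_EVT_min _ Kc (continuous_subspaceT (Gc om)).
  by exists (map_mx ratr (projT1 (qP 0%N))); exact: Kq.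
(* A positive minimum over the box would be at least some [j.+1%:R^-1], but the [j]-th rational
   point is in the box and has a smaller value. *)
exists v; rewrite leNgt; apply/negP => Gv0.
pose j := Num.bound (G v om)^-1.
have : G v om < j.+1%:R^-1.
  apply: le_lt_trans (projT2 (qP j)); apply: vmin; rewrite inE; exact: Kq.
apply/negP; rewrite -leNgt -[leRHS]invrK lef_pV2 ?posrE ?invr_gt0//.
apply: ltW; apply: (@lt_trans _ _ j%:R); last by rewrite ltr_nat.
by apply: archi_boundP; rewrite invr_ge0 ltW.
Qed.

Lemma continuous_maxr (R : realType) (V : topologicalType) (f g : V -> R) :
  continuous f -> continuous g -> continuous (fun v => Num.max (f v) (g v)).
Proof. by move=> fc gc v; apply: continuous_max; [exact: fc|exact: gc]. Qed.

Lemma continuous_subr (R : realType) (V : topologicalType) (f g : V -> R) :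
  continuous f -> continuous g -> continuous (fun v => f v - g v).
Proof. by move=> fc gc v; apply: continuousB; [exact: fc|exact: gc]. Qed.

Lemma continuous_subr_cst (R : realType) (V : topologicalType) (f : V -> R) (b : R) :
  continuous f -> continuous (fun v => f v - b).
Proof. by move=> fc; apply: continuous_subr => // v; exact: cvg_cst. Qed.

Lemma continuous_cst_subr (R : realType) (V : topologicalType) (f : V -> R) (b : R) :
  continuous f -> continuous (fun v => b - f v).
Proof. by move=> fc; apply: continuous_subr => // v; exact: cvg_cst. Qed.

Section ResidualRegularity.
Context {R : realType} (p q : nat).

Lemma continuous_linf_residual (V : topologicalType) (A : V -> 'M[R]_(p, q))
    (y : 'cV[R]_p) (z : 'cV[R]_q) :
  (forall i j, continuous (fun v => A v i j)) ->
  continuous (fun v => linf_norm (y - A v *m z)).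
Proof.
move=> Ac; apply: continuous_bigmax => i v.
apply: (@continuous_comp _ _ _ (fun v => (y - A v *m z) i 0) Num.norm); last exact: norm_continuous.
rewrite (_ : (fun _ => _) = (fun v => y i 0 - \sum_j A v i j * z j 0)); last first.
  by apply/funext => ?; rewrite !mxE.
apply: continuousB; first exact: cvg_cst.
apply: continuous_bigsum => j {}v.
by apply: continuousM; [exact: Ac|exact: cvg_cst].
Qed.

Lemma continuous_frob_norm (V : topologicalType) (A : V -> 'M[R]_(p, q)) :
  (forall i j, continuous (fun v => A v i j)) -> continuous (fun v => frob_norm (A v)).
Proof.
move=> Ac v.
apply: (@continuous_comp _ _ _ (fun v => \sum_i \sum_j A v i j ^+ 2) Num.sqrt);
  last exact: sqrt_continuous.
apply: continuous_bigsum => i; apply: continuous_bigsum => j {}v.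
by apply: continuousM; exact: Ac.
Qed.

Lemma measurable_linf_residual d (T : measurableType d) (A : 'M[R]_(p, q))
    (y : T -> 'cV[R]_p) (z : T -> 'cV[R]_q) :
  random_vector y -> random_vector z ->
  measurable_fun setT (fun om => linf_norm (y om - A *m z om)).
Proof.
move=> ym zm; apply: measurable_bigmax => i.
apply: measurableT_comp; first exact: measurable_realfun.normr_measurable.
rewrite (_ : (fun _ => _) = (fun om => y om i 0 - \sum_j A i j * z om j 0)); last first.
  by apply/funext => ?; rewrite !mxE.
apply: measurable_realfun.measurable_funB; first exact: ym.
apply: measurable_sum => j.
by apply: measurable_realfun.measurable_funM; [exact: measurable_cst|exact: zm].
Qed.

End ResidualRegularity.

Lemma bigmax_ord_leP (R : realDomainType) (n : nat) (b c : R) (f : 'I_n -> R) :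
  \big[Num.max/b]_(i < n) f i <= c <-> b <= c /\ forall i, f i <= c.
Proof.
split=> [|[bc fc]]; last by apply/bigmax_leP; split.
by move=> /bigmax_leP[bc fc]; split => // i; exact: fc.
Qed.

(** Both matrices are packed into one row vector. The strict inequality is a countable union over
    [k] of closed conditions with slack [k.+1%:R^-1]; bounding the coordinates by [k] supplies the
    coercivity. *)
Lemma measurable_far_pair d (T : measurableType d) (R : realType) (p q N : nat)
    (y : nat -> T -> 'cV[R]_p) (z : nat -> T -> 'cV[R]_q) (c w : R) :
  (forall t, random_vector (y t)) -> (forall t, random_vector (z t)) -> 0 <= w ->
  measurable [set om | exists A B : 'M[R]_(p, q), [/\ c < frob_norm (A - B),
    forall t, (t < N)%N -> linf_norm (y t om - A *m z t om) <= w
  & forall t, (t < N)%N -> linf_norm (y t om - B *m z t om) <= w]].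
Proof.
move=> ym zm w0.
pose L (v : 'rV[R]_(p * q + p * q)) : 'M[R]_(p, q) := vec_mx (lsubmx v).
pose S (v : 'rV[R]_(p * q + p * q)) : 'M[R]_(p, q) := vec_mx (rsubmx v).
have Lc i j : continuous (fun v => L v i j).
  rewrite (_ : (fun _ => _) = (fun v : 'rV[R]_(p * q + p * q) => v 0 (lshift _ (mxvec_index i j)))).
    exact: coord_continuous.
  by apply/funext => v; rewrite !mxE.
have Sc i j : continuous (fun v => S v i j).
  rewrite (_ : (fun _ => _) = (fun v : 'rV[R]_(p * q + p * q) => v 0 (rshift _ (mxvec_index i j)))).
    exact: coord_continuous.
  by apply/funext => v; rewrite !mxE.
(* All constraints become the single condition [G <= 0]. The starting value [- w] of the inner
   maximum is harmless because [0 <= w], also for [N = 0]. *)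
pose G k (v : 'rV[R]_(p * q + p * q)) om : R :=
  Num.max (Num.max (\big[Num.max/0]_i `|v 0 i| - k%:R)
                   (c + k.+1%:R^-1 - frob_norm (L v - S v)))
    (\big[Num.max/- w]_(t < N) (Num.max (linf_norm (y t om - L v *m z t om))
                                        (linf_norm (y t om - S v *m z t om)) - w)).
have GP k v om : G k v om <= 0 <->
  [/\ forall i, `|v 0 i| <= k%:R, c + k.+1%:R^-1 <= frob_norm (L v - S v),
    forall t, (t < N)%N -> linf_norm (y t om - L v *m z t om) <= w
  & forall t, (t < N)%N -> linf_norm (y t om - S v *m z t om) <= w].
  rewrite /G !ge_max !subr_le0; split.
    move=> /andP[/andP[/bigmax_ord_leP[_ vk] cL] /bigmax_ord_leP[_ LS]].
    split=> // t tN; have := LS (Ordinal tN); rewrite subr_le0 ge_max => /andP[//].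
  move=> [vk cL Lw Sw]; rewrite cL andbT; apply/andP; split.
    by apply/bigmax_ord_leP; split.
  apply/bigmax_ord_leP; split; first by rewrite oppr_le0.
  by move=> t; rewrite subr_le0 ge_max Lw// Sw.
rewrite (_ : [set _ | _] = \bigcup_k [set om | exists v, G k v om <= 0]).
  apply: bigcupT_measurable => k; apply: (@measurable_exists_le0 _ _ _ _ _ k%:R).
  - move=> om; apply: continuous_maxr; first apply: continuous_maxr.
    + apply: continuous_subr_cst.
      apply: continuous_bigmax => i {}v.
      apply: (@continuous_comp _ _ _ (fun v : 'rV[R]_(p * q + p * q) => v 0 i) Num.norm).
        exact: coord_continuous.
      exact: norm_continuous.
    + apply: continuous_cst_subr.
      apply: continuous_frob_norm => i j.
      rewrite (_ : (fun _ => _) = (fun v => L v i j - S v i j)).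
        exact: continuous_subr.
      by apply/funext => ?; rewrite !mxE.
    + apply: continuous_bigmax => t; apply: continuous_subr_cst.
      by apply: continuous_maxr; apply: continuous_linf_residual.
  - move=> v; apply: measurable_realfun.measurable_maxr; first exact: measurable_cst.
    apply: measurable_bigmax => t.
    apply: measurable_realfun.measurable_funB; last exact: measurable_cst.
    by apply: measurable_realfun.measurable_maxr; apply: measurable_linf_residual.
  - move=> v om i; rewrite /G !le_max lerD2r.
    by rewrite (le_bigmax _ (fun i => `|v 0 i|)).
apply/seteqP; split => om /=.
  move=> [A [B [cAB Aw Bw]]].
  pose v : 'rV[R]_(p * q + p * q) := row_mx (mxvec A) (mxvec B).
  have Lv : L v = A by rewrite /L row_mxKl mxvecK.
  have Sv : S v = B by rewrite /S row_mxKr mxvecK.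
  pose b := \big[Num.max/0]_i `|v 0 i|.
  have b0 : 0 <= b by apply: bigmax_ge_id.
  pose e := (frob_norm (A - B) - c)^-1.
  have e0 : 0 < e by rewrite invr_gt0 subr_gt0.
  (* One [k] exceeds both the coordinates and the inverse of the gap between the distance and
     [c]. *)
  pose k := Num.bound (b + e).
  have bek : b + e < k%:R by apply: archi_boundP; rewrite addr_ge0// ltW.
  exists k => //; exists v; apply/GP; rewrite Lv Sv; split=> //.
    move=> i; apply: (@le_trans _ _ b); first exact: (le_bigmax _ (fun i => `|v 0 i|)).
    by move: bek; lra.
  rewrite -lerBrDl -[leRHS]invrK lef_pV2 ?posrE// -/e -natr1.
  by move: bek; lra.
move=> [k _ [v /GP[_ cLS Lw Sw]]]; exists (L v), (S v); split=> //.
by apply: lt_le_trans cLS; rewrite ltrDl invr_gt0.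
Qed.

(** A supremum exceeds [c] strictly iff some pair does. Measurability is what allows the event to be
    compared with the bad events by monotonicity. *)
Lemma measurable_diam_Theta_hat d (T : measurableType d) (R : realType) (nx nu N : nat)
    (x : nat -> T -> 'cV[R]_nx) (u : nat -> T -> 'cV[R]_nu) (c w : R) :
  (forall t, random_vector (x t)) -> (forall t, random_vector (zvec x u t)) -> 0 <= w ->
  measurable [set om | (c%:E < diam (Theta_hat x u N w om))%E].
Proof.
move=> xm zm w0.
have := @measurable_far_pair _ _ _ _ _ N (fun t => x t.+1) _ c _ (fun t => xm t.+1) zm w0.
rewrite (_ : [set om | exists A B, _] = [set om | (c%:E < diam (Theta_hat x u N w om))%E])//.
apply/seteqP; split => om /=.
  move=> [A [B [cAB Aw Bw]]]; rewrite -lte_fin in cAB; apply: lt_le_trans cAB _.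
  by apply: ereal_sup_ubound; exists A => //; exists B.
move=> /ereal_sup_gt[_ [A Aw [B Bw <-]]]; rewrite lte_fin => cAB.
by exists A, B; split.
Qed.

(** * Deterministic excitation argument *)

Lemma exists_ge_mean (R : realFieldType) (n : nat) (f : 'I_n -> R) :
  \sum_i f i = 1 -> exists i, n%:R^-1 <= f i.
Proof.
move=> f1; apply/existsP; apply: contra_eqT f1; rewrite negb_exists => /forallP fn.
have [n0|n0] := posnP n.
  by subst n; rewrite big_ord0 eq_sym oner_eq0.
rewrite lt_eqF// -[ltRHS](@divff _ n%:R) ?pnatr_eq0 -?lt0n//.
apply: (@lt_le_trans _ _ (\sum_(i < n) n%:R^-1)); last first.
  by rewrite sumr_const card_ord mulr_natl.
apply: ltr_sum => [|i _]; last by rewrite ltNge fn.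
by apply/hasP; exists (Ordinal n0); rewrite ?mem_index_enum.
Qed.

Lemma sub_dot (R : realFieldType) (I : finType) (f g z : I -> R) :
  \sum_i f i * z i = \sum_i g i * z i + \sum_i (f i - g i) * z i.
Proof. by rewrite -big_split/=; apply: eq_bigr => i _; ring. Qed.

Section Deterministic.
Context {R : realType} (nx nz : nat).
Variables (s al b : R) (S1 : seq {ffun 'I_nz -> R}) (S2 : seq {ffun 'I_nx * 'I_nz -> R}).
Hypotheses (s0 : 0 < s) (sb : s <= b) (al0 : 0 < al) (als : 4 * al <= s) (nx0 : (0 < nx)%N).

Let b0 : 0 < b. Proof. exact: lt_le_trans sb. Qed.

(** Some row of an [nx]-row matrix of Frobenius norm 1 has norm at least [y]. *)
Let y : R := (Num.sqrt nx%:R)^-1.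
Let y0 : 0 < y. Proof. by rewrite invr_gt0 sqrtr_gt0 ltr0n. Qed.
Let yE : y ^+ 2 = nx%:R^-1. Proof. by rewrite exprVn sqr_sqrtr// ler0n. Qed.

(* Excitation gives |(v z)_j| >= 7/8 s y for the unit direction v and some row j;
   replacing v by its net point costs 5/4 al y, and coming back costs as much again. *)
Definition hit_level : R := (7 / 8 * s - 5 / 4 * al) * y.

Lemma hit_level_gt0 : 0 < hit_level.
Proof. by rewrite mulr_gt0//; move: al0 als; lra. Qed.

Hypothesis net1 : forall f : 'I_nz -> R, \sum_i f i ^+ 2 <= 1 ->
  exists2 g, g \in S1 & \sum_i (f i - g i) ^+ 2 <= (s / (16 * b)) ^+ 2.

(** Since [s <= b], the net point has norm at least [15 / 16], and replacing it by [f] changes the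
    product with [z] by at most [s / 16]; this leaves [7 / 8 * s]. *)
Lemma excitation (f : 'I_nz -> R) : \sum_i f i ^+ 2 = 1 ->
  exists2 g, g \in S1 & forall z : 'I_nz -> R, \sum_i z i ^+ 2 <= b ^+ 2 ->
    Num.sqrt (\sum_i g i ^+ 2) * s <= `|\sum_i g i * z i| ->
    7 / 8 * s <= `|\sum_i f i * z i|.
Proof.
move=> f1; have [g gS fg] : exists2 g, g \in S1 & \sum_i (f i - g i) ^+ 2 <= (s / (16 * b)) ^+ 2.
  by apply: net1; rewrite f1.
exists g => // z zb gz.
have e0 : 0 <= s / (16 * b) by rewrite divr_ge0 ?mulr_ge0// ltW.
have eb : s / (16 * b) * b = s / 16 by field; rewrite lt0r_neq0.
have e1 : s / (16 * b) <= 1 / 16.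
  rewrite invfM mulrA ler_pdivrMr// mulrAC ler_pdivrMr//; move: sb; lra.
have fgz := norm_dot_le e0 (ltW b0) fg zb.
have f1' : \sum_i f i ^+ 2 <= 1 ^+ 2 by rewrite f1 expr1n.
have ff : \sum_i f i * f i = 1 by rewrite -f1; apply: eq_bigr => i _; rewrite expr2.
have g0 : 0 <= \sum_i g i ^+ 2 by apply: sumr_ge0 => i _; exact: sqr_ge0.
(* The norm of [g] is at least its inner product with the unit vector [f]. *)
have gn : 1 - s / (16 * b) <= Num.sqrt (\sum_i g i ^+ 2).
  have h1 := norm_dot_le e0 ler01 fg f1'.
  have h2 : `|\sum_i g i * f i| <= Num.sqrt (\sum_i g i ^+ 2) * 1.
    by apply: norm_dot_le => //; rewrite ?sqrtr_ge0// sqr_sqrtr.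
  have := sub_dot f g f; rewrite ff => h3.
  by move: h1 h2; rewrite !ler_norml => /andP[_ h1] /andP[_ h2]; lra.
have : (1 - s / (16 * b)) * s <= `|\sum_i g i * z i|.
  by apply: le_trans gz; rewrite ler_wpM2r// ltW.
have h4 : s / (16 * b) * s <= 1 / 16 * s by rewrite ler_wpM2r// ltW.
have h5 := ler_normB (\sum_i f i * z i) (\sum_i (f i - g i) * z i).
rewrite {1}(sub_dot f g z) addrK in h5.
rewrite eb in fgz; move: h4 h5 fgz; lra.
Qed.

Hypothesis net2 : forall f : 'I_nx * 'I_nz -> R, \sum_i f i ^+ 2 <= 1 ->
  exists2 g, g \in S2 & \sum_i (f i - g i) ^+ 2 <= (5 * al * y / (4 * b)) ^+ 2.

Variables (W : nat -> 'cV[R]_nx) (Z : nat -> 'cV[R]_nz) (ga : 'M[R]_(nx, nz)).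
Variables (T K l : nat) (what wmax delta : R).
Hypothesis Zb : forall t, \sum_i Z t i 0 ^+ 2 <= b ^+ 2.
Hypothesis hits : forall g k, g \in S1 -> (k < K)%N ->
  exists2 t, (k * l < t <= k * l + l)%N &
    Num.sqrt (\sum_i g i ^+ 2) * s <= `|\sum_i g i * Z t i 0|.
Hypothesis residual : forall t, (t < T)%N -> forall j, `|W t j 0 - (ga *m Z t) j 0| <= what.
Hypothesis KlT : (K * l < T)%N.
Hypothesis wmax_le : wmax <= what.
Hypothesis delta0 : 0 < delta.
Hypothesis ga_large : delta / 2 + 2 * (what - wmax) / (al * y) < frob_norm ga.

Let ep := al * delta * y / 4.

(** Normalise [ga], take a net point [g] and a heavy row [j]. At a hit, [(ga *m Z t) j 0] is so
    large that a residual within [what] keeps the noise away from the end of its range that has the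
    opposite sign. *)
Lemma missed_noise : exists g j, [/\ g \in S2,
  forall k, (k < K)%N -> exists2 t, (k * l < t <= k * l + l)%N &
    hit_level <= `|\sum_i g (j, i) * Z t i 0|
  & forall t, (0 < t <= K * l)%N -> hit_level <= `|\sum_i g (j, i) * Z t i 0| ->
    (hit_level <= \sum_i g (j, i) * Z t i 0 /\ ep - wmax < W t j 0) \/
    (\sum_i g (j, i) * Z t i 0 <= - hit_level /\ W t j 0 < wmax - ep)].
Proof.
have aly0 : 0 < al * y by rewrite mulr_gt0.
pose r := frob_norm ga; have r_large : delta / 2 + 2 * (what - wmax) / (al * y) < r := ga_large.
have r0 : 0 < r.
  apply: le_lt_trans r_large; rewrite addr_ge0// ?divr_ge0 ?mulr_ge0 ?subr_ge0//; exact: ltW.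
pose v j i := ga j i / r.
have r2 : r ^+ 2 = \sum_j \sum_i ga j i ^+ 2.
  by rewrite sqr_sqrtr// sumr_ge0// => j _; apply: sumr_ge0 => i _; exact: sqr_ge0.
have v1 : \sum_j \sum_i v j i ^+ 2 = 1.
  under eq_bigr do under eq_bigr do rewrite exprMn.
  under eq_bigr do rewrite -mulr_suml.
  by rewrite -mulr_suml -r2 exprVn divff// expf_neq0// lt0r_neq0.
have [g gS vg] : exists2 g, g \in S2 &
    \sum_p (v p.1 p.2 - g p) ^+ 2 <= (5 * al * y / (4 * b)) ^+ 2.
  apply: (net2 (f := fun p => v p.1 p.2)).
  by rewrite -(pair_big xpredT xpredT (fun j i => v j i ^+ 2))/= v1.
have [j vj] := exists_ge_mean v1.
set rho2 := \sum_i v j i ^+ 2 in vj; pose rho := Num.sqrt rho2.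
have rho20 : 0 < rho2 by apply: lt_le_trans vj; rewrite invr_gt0 ltr0n.
have rho0 : 0 < rho by rewrite sqrtr_gt0.
have rhoE : rho ^+ 2 = rho2 by rewrite sqr_sqrtr// ltW.
have yrho : y <= rho by rewrite -(ler_pXn2r (n := 2)) ?nnegrE ?rhoE ?yE//; exact: ltW.
have e0 : 0 <= 5 * al * y / (4 * b) by rewrite divr_ge0 ?mulr_ge0// ltW.
have vgj : \sum_i (v j i - g (j, i)) ^+ 2 <= (5 * al * y / (4 * b)) ^+ 2.
  apply: le_trans vg.
  have -> : \sum_p (v p.1 p.2 - g p) ^+ 2 = \sum_j \sum_i (v j i - g (j, i)) ^+ 2.
    by rewrite pair_bigA; apply: eq_bigr => -[].
  rewrite (bigD1 j)//= lerDl sumr_ge0// => k _; apply: sumr_ge0 => i _; exact: sqr_ge0.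
have eb : 5 * al * y / (4 * b) * b = 5 / 4 * al * y by field; rewrite lt0r_neq0.
have close t := norm_dot_le e0 (ltW b0) vgj (Zb t); rewrite eb in close.
have rowE t : \sum_i v j i * Z t i 0 = (ga *m Z t) j 0 / r.
  by rewrite mxE mulr_suml; apply: eq_bigr => i _; rewrite /v mulrAC.
exists g, j; split => //.
  (* Row [j] is scaled to norm 1, excited through [S1], and scaled back by [rho >= y]. *)
  move=> k kK; have lam1 : \sum_i (v j i / rho) ^+ 2 = 1.
    under eq_bigr do rewrite exprMn.
    by rewrite -mulr_suml -/rho2 exprVn rhoE divff// lt0r_neq0.
  have [e eS he] := excitation lam1.
  have [t tk et] := hits eS kK; exists t => //.
  have := he (fun i => Z t i 0) (Zb t) et.
  have -> : \sum_i v j i / rho * Z t i 0 = (\sum_i v j i * Z t i 0) / rho.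
    by rewrite mulr_suml; apply: eq_bigr => i _; ring.
  rewrite normrM normfV (gtr0_norm rho0) ler_pdivlMr// => hv.
  have : 7 / 8 * s * y <= `|\sum_i v j i * Z t i 0|.
    by apply: le_trans hv; rewrite ler_wpM2l// mulr_ge0// ltW.
  have := ler_normB (\sum_i v j i * Z t i 0) (\sum_i g (j, i) * Z t i 0).
  have := ler_normD (\sum_i g (j, i) * Z t i 0) (\sum_i (v j i - g (j, i)) * Z t i 0).
  rewrite -(sub_dot (v j) (fun i => g (j, i)) (fun i => Z t i 0)) /hit_level.
  by move: (close t); lra.
move=> t /andP[t0 tK] ht.
have tT : (t < T)%N by apply: leq_ltn_trans tK KlT.
have res := residual tT j; rewrite ler_distl in res.
have := sub_dot (v j) (fun i => g (j, i)) (fun i => Z t i 0).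
rewrite rowE => sd.
have := close t; rewrite ler_norml => /andP[c1 c2].
(* Multiplying [ga_large] by [al * y] gives [2 * ep + 2 * (what - wmax)], twice what is required. *)
have large : ep + (what - wmax) < r * (al * y).
  move: r_large; rewrite -(ltr_pM2r aly0) mulrDl divfK ?lt0r_neq0//.
  have : 0 < al * y * delta by rewrite mulr_gt0.
  by rewrite /ep; move: wmax_le; lra.
(* This is where [4 * al <= s] enters: [7 / 8 * s - 5 / 2 * al >= al]. *)
have lev : al * y <= hit_level - 5 / 4 * al * y.
  have : 0 <= (s - 4 * al) * y by rewrite mulr_ge0 ?subr_ge0// ltW.
  by rewrite /hit_level; lra.
move: ht; rewrite ler_normr => /orP[ht|ht]; [left|right]; split=> //.
- have : r * (al * y) <= (ga *m Z t) j 0.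
    by rewrite mulrC -ler_pdivlMr//; move: sd c1 ht lev; lra.
  by move: res => /andP[]; move: large; lra.
- by move: ht; lra.
- have : (ga *m Z t) j 0 <= - (r * (al * y)).
    by rewrite mulrC -mulNr -ler_pdivrMr//; move: sd c2 ht lev; lra.
  by move: res => /andP[]; move: large; lra.
Qed.

End Deterministic.

(** * Constants *)

(** With [k = T.-1 %/ m] one has [k * m < T <= k.+1 * m]. *)
Lemma ceil_natdiv (R : realType) (T m : nat) : (0 < m)%N -> (0 < T)%N ->
  Num.ceil (T%:R / m%:R : R) = (T.-1 %/ m).+1 :> int.
Proof.
move=> m0 T0; apply: ceil_def.
have mR : 0 < m%:R :> R by rewrite ltr0n.
have := divn_eq T.-1 m; have := ltn_pmod T.-1 m0; set k := (T.-1 %/ m)%N => lt_m eqT.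
have -> : (k.+1 : int) - 1 = k by lia.
rewrite -!pmulrn ltr_pdivlMr// ler_pdivrMr// -!natrM ltr_nat ler_nat.
by apply/andP; split; lia.
Qed.

Section Constants.
Context {R : realType}.
Variables (s p b : R).
Hypotheses (s0 : 0 < s) (p0 : 0 < p) (p1 : p <= 1) (sb : s <= b).

Let b0 : 0 < b. Proof. exact: lt_le_trans sb. Qed.
Let B := b / s.
Let B1 : 1 <= B. Proof. by rewrite ler_pdivlMr// mul1r. Qed.

Lemma a1_gt0 : 0 < a1 s p.
Proof. by rewrite divr_gt0// mulr_gt0. Qed.

Lemma a1_le : 4 * a1 s p <= s.
Proof. by rewrite /a1 mulrCA divff ?mulr1// ler_piMr// ltW. Qed.

(** [a2] is [64 * B ^+ 2 / p ^+ 2], with [B >= 1] and [p <= 1]. *)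
Lemma a2_ge : 64 * B <= a2 s p b.
Proof.
have -> : a2 s p b = 64 * (B * (B / p ^+ 2)).
  by rewrite /a2 /B; field; rewrite !lt0r_neq0.
rewrite ler_pM2l// ler_peMr//; first by apply: le_trans B1.
by rewrite ler_pdivlMr ?exprn_gt0// mul1r (le_trans _ B1)// expr_le1// ltW.
Qed.

Lemma a4_ge nx : (0 < nx)%N -> 16 <= a4 nx s p b.
Proof.
move=> nx0; have sq1 : 1 <= Num.sqrt nx%:R :> R by rewrite -[leLHS]sqrtr1 ler_sqrt// ler1n.
rewrite /a4 ler_pdivlMr ?a1_gt0//.
apply: (@le_trans _ _ (4 * b)); first by have := a1_le; move: sb; lra.
by rewrite ler_peMr// mulr_ge0// ltW.
Qed.

Lemma ln_ge1 (x : R) : 3 <= x -> 1 <= ln x.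
Proof.
move=> x3; rewrite -[leLHS]expRK ler_ln ?posrE ?expR_gt0//; last by apply: lt_le_trans x3.
exact: le_trans (expR1_le3 R) x3.
Qed.

Lemma natr_powR_ge (n : nat) : (0 < n)%N -> n%:R <= n%:R `^ (5 / 2) :> R.
Proof.
move=> n0; rewrite -[leLHS]powRr1//; apply: ler_powR; first by rewrite ler1n.
by lra.
Qed.

(** The left side is windows times net size times miss probability. The net base is
    [6 + 48 * B <= 64 * B <= a2], and the remaining constant [2 * 3] is far below 544. *)
Lemma bbT1_ge (nz T m : nat) : (0 < nz)%N -> (0 < m)%N -> (m < T)%N ->
  (T.-1 %/ m).+1%:R * ((3 * (2 + (s / (16 * b))^-1)) ^+ nz * (1 - p) ^+ m./2)
    <= bbT1 nz T m s p b.
Proof.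
move=> nz0 m0 mT; have mR : 0 < m%:R :> R by rewrite ltr0n.
have K2 : (T.-1 %/ m).+1%:R <= 2 * (T%:R / m%:R) :> R.
  rewrite mulrA ler_pdivlMr// -natrM -natrM ler_nat.
  by have := leq_trunc_div T.-1 m; rewrite mulSn; lia.
have a2B := a2_ge.
have a2_ge64 : 64 <= a2 s p b by apply: le_trans a2B; move: B1; lra.
have net : (3 * (2 + (s / (16 * b))^-1)) ^+ nz <= a2 s p b ^+ nz.
  have -> : 3 * (2 + (s / (16 * b))^-1) = 3 * (2 + 16 * B).
    by rewrite /B; field; rewrite !lt0r_neq0.
  rewrite lerXn2r// ?nnegrE//; [|by move: a2_ge64; lra|]; by move: a2B B1; lra.
(* [m./2 >= (m - 1) / 2], so rounding costs at most [expR (p / 2)], which is absorbed in the factor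
   3; then [p / 2 >= a3]. *)
have hit : (1 - p) ^+ m./2 <= 3 * expR (- (a3 p * m%:R)).
  apply: (@le_trans _ _ (expR (- p) ^+ m./2)).
    by rewrite lerXn2r ?nnegrE ?expR_ge0 ?subr_ge0// expR_ge1Dx.
  apply: (@le_trans _ _ (expR 1 * expR (- (a3 p * m%:R)))); last first.
    by rewrite ler_wpM2r ?expR_ge0// expR1_le3.
  rewrite -expRM_natl -expRD ler_expR.
  have half : m%:R <= 2 * m./2%:R + 1 :> R.
    by rewrite -natrM natr1 ler_nat; have := odd_double_half m; case: (odd m); lia.
  have pp : p ^+ 2 * m%:R <= p * m%:R by rewrite ler_wpM2r// expr2 ler_piMr// ltW.
  have : p * m%:R <= p * (2 * m./2%:R + 1) by rewrite ler_wpM2l// ltW.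
  rewrite /a3; have : 0 <= p * m%:R by rewrite mulr_ge0// ltW.
  by move: pp p1; lra.
have Tm : 0 <= T%:R / m%:R :> R by rewrite divr_ge0.
have a20 : 0 <= a2 s p b ^+ nz by rewrite exprn_ge0//; move: a2_ge64; lra.
have e0 := expR_ge0 (- (a3 p * m%:R)).
have q0 : 0 <= (1 - p) ^+ m./2 by rewrite exprn_ge0// subr_ge0.
have nz1 : 1 <= nz%:R :> R by rewrite ler1n.
have pw : 1 <= nz%:R `^ (5 / 2) :> R by apply: le_trans nz1 (natr_powR_ge nz0).
have lg : 1 <= ln (a2 s p b * nz%:R).
  apply: ln_ge1; apply: (@le_trans _ _ (a2 s p b)); first by move: a2_ge64; lra.
  by rewrite ler_peMr//; move: a2_ge64; lra.
have net0 : 0 <= (3 * (2 + (s / (16 * b))^-1)) ^+ nz.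
  by rewrite exprn_ge0// mulr_ge0// addr_ge0// invr_ge0 divr_ge0 ?mulr_ge0// ltW.
apply: (@le_trans _ _ (2 * (T%:R / m%:R) * (a2 s p b ^+ nz * (3 * expR (- (a3 p * m%:R)))))).
  by rewrite ler_pM ?mulr_ge0// ler_pM.
rewrite /bbT1.
have -> : 2 * (T%:R / m%:R) * (a2 s p b ^+ nz * (3 * expR (- (a3 p * m%:R))))
        = 6 * (T%:R / m%:R) * 1 * 1 * a2 s p b ^+ nz * expR (- (a3 p * m%:R)) by ring.
rewrite ler_wpM2r// ler_wpM2r// ler_pM ?mulr_ge0//.
by rewrite ler_pM ?mulr_ge0// ler_wpM2r//; lra.
Qed.

(** A net of radius [5 / a4] has base [6 + 3 / 5 * a4], at most [a4] because [a4 >= 16]. The factor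
    [nx] for the choice of row goes into the power of [nx * nz]. *)
Lemma bbT2_ge (nx nz T m : nat) (qw : R -> R) (delta : R) :
  (0 < nx)%N -> (0 < nz)%N -> (0 < m)%N -> (m < T)%N ->
  qw (a1 s p * delta / (4 * Num.sqrt nx%:R)) <= 1 ->
  nx%:R * ((3 * (2 + (5 / a4 nx s p b)^-1)) ^+ (nx * nz)
    * (1 - qw (a1 s p * delta / (4 * Num.sqrt nx%:R))) ^+ (T.-1 %/ m).+1)
  <= bbT2 nx nz T m s p b qw delta.
Proof.
move=> nx0 nz0 m0 mT; rewrite /bbT2 ceil_natdiv//; last exact: leq_ltn_trans mT.
set q := qw _ => q1; have a4_16 := a4_ge nx0.
have N0 : (0 < nx * nz)%N by rewrite muln_gt0 nx0.
have net : (3 * (2 + (5 / a4 nx s p b)^-1)) ^+ (nx * nz) <= a4 nx s p b ^+ (nx * nz).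
  by rewrite invf_div lerXn2r// ?nnegrE//; move: a4_16; lra.
have q0 : 0 <= (1 - q) ^+ (T.-1 %/ m).+1 by rewrite exprn_ge0// subr_ge0.
have nxp : nx%:R <= (nx * nz)%:R `^ (5 / 2) :> R.
  by apply: le_trans (natr_powR_ge N0); rewrite ler_nat leq_pmulr.
have N1 : 1 <= (nx * nz)%:R :> R by rewrite ler1n.
have lg : 1 <= ln (a4 nx s p b * (nx * nz)%:R).
  apply: ln_ge1; apply: (@le_trans _ _ (a4 nx s p b)); first by move: a4_16; lra.
  by rewrite ler_peMr//; move: a4_16; lra.
have a40 : 0 <= a4 nx s p b ^+ (nx * nz) by rewrite exprn_ge0//; move: a4_16; lra.
rewrite mulrA -exprnP ler_wpM2r// -[X in _ <= X]mulrA.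
have net0 : 0 <= (3 * (2 + (5 / a4 nx s p b)^-1)) ^+ (nx * nz).
  by rewrite exprn_ge0// invf_div; move: a4_16; lra.
rewrite [leRHS]mulrA ler_pM// -[leLHS]mulr1 ler_pM//.
by apply: le_trans nxp _; rewrite ler_peMl ?powR_ge0//; lra.
Qed.

End Constants.

(** * Bad events *)

Lemma probability_bigsetU_le d (T : measurableType d) (R : realType)
    (P : probability T R) (I : Type) (s : seq I) (F : I -> set T) (c : R) :
  (forall i, measurable (F i)) -> (forall i, (P (F i) <= c%:E)%E) ->
  (P (\big[setU/set0]_(i <- s) F i) <= ((size s)%:R * c)%:E)%E.
Proof.
move=> mF Fc; elim: s => [|i s IH]; first by rewrite big_nil measure0 mul0r.
rewrite big_cons -[(size (i :: s))]/((size s).+1).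
apply: le_trans (measureU2 _ (mF i) (bigsetU_measurable _ _)) _ => //.
have -> : (size s).+1%:R * c = c + (size s)%:R * c by rewrite -natr1; ring.
by rewrite EFinD; apply: leeD; [exact: Fc|exact: IH].
Qed.

Section PastEvents.
Context {d : measure_display} {T : measurableType d} {R : realType} (nx nz : nat).
Variables (w : nat -> T -> 'cV[R]_nx) (z : nat -> T -> 'cV[R]_nz).
Hypothesis w_measurable : forall t, random_vector (w t).
Hypothesis z_measurable : forall t, random_vector (z t).

(** Generators of [filtration], kept apart from their closure: [<<s past t >>] is convertible to
    [filtration w z t]. *)
Definition past t : set (set T) :=
  [set A | (exists2 s, (s < t)%N & coord_events (w s) A)
        \/ (exists2 s, (s <= t)%N & coord_events (z s) A)].

Lemma coord_event n (f : T -> 'cV[R]_n) (j : 'I_n) (B : set R) :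
  measurable B -> coord_events f [set om | B (f om j 0)].
Proof. by move=> mB; exists j, B. Qed.

Lemma coord_events_measurable n (f : T -> 'cV[R]_n) :
  random_vector f -> coord_events f `<=` measurable.
Proof.
move=> fm A [i [B [mB ->]]]; rewrite -[X in measurable X]setTI; exact: fm.
Qed.

Lemma past_measurable t : past t `<=` measurable.
Proof. by move=> A [] [s _]; apply: coord_events_measurable. Qed.

Lemma past_mono s t : (s <= t)%N -> past s `<=` past t.
Proof.
move=> st A [] [r rs Ar]; [left|right]; exists r => //; first exact: leq_trans st.
exact: leq_trans st.
Qed.

Definition dot (f : 'I_nz -> R) t om : R := \sum_i f i * z t om i 0.

Lemma past_dot (f : 'I_nz -> R) t :
  measurable_fun (setT : set (g_sigma_algebraType (past t))) (dot f t).
Proof.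
apply: measurable_sum => i.
apply: measurable_realfun.measurable_funM; first exact: measurable_cst.
move=> _ B mB; rewrite setTI; apply: sub_sigma_algebra; right; exists t => //.
exact: coord_event.
Qed.

Lemma past_dot_ge (f : 'I_nz -> R) c t : <<s past t >> [set om | c <= dot f t om].
Proof.
exact: (measurable_cst_le c (@past_dot f t)).
Qed.

Lemma past_dot_le (f : 'I_nz -> R) c t : <<s past t >> [set om | dot f t om <= c].
Proof.
rewrite (_ : [set _ | _] = [set om | - c <= dot (fun i => - f i) t om]).
  exact: past_dot_ge.
apply/funext => om/=; rewrite /dot; under [in RHS]eq_bigr do rewrite mulNr.
by rewrite sumrN lerN2.
Qed.

Lemma past_norm_dot_ge (f : 'I_nz -> R) c t : <<s past t >> [set om | c <= `|dot f t om|].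
Proof.
rewrite (_ : [set _ | _] = [set om | c <= dot f t om] `|` [set om | dot f t om <= - c]).
  by apply: gen_setU; [exact: past_dot_ge|exact: past_dot_le].
apply/seteqP; split => om /=; rewrite ler_normr lerNr => /orP; last by [].
by [].
Qed.

Variables (P : probability T R) (s p : R).
Hypothesis p1 : p <= 1.
Hypothesis spread : forall (lam : 'cV[R]_nz) (t : nat), l2_norm lam = 1 ->
  forall E, <<s past t >> E ->
  (p%:E * P E <= P (E `&` [set om | (s <= `|(lam^T *m z t.+1 om) 0 0|)%R]))%E.

Let wide (g : 'I_nz -> R) t := [set om | Num.sqrt (\sum_i g i ^+ 2) * s <= `|dot g t om|].

(** Net points need not be unit vectors, so the level scales with the norm of [g]; for [g] of norm 0
    the event is everything. *)
Lemma spread_dot g t E : <<s past t >> E -> (p%:E * P E <= P (E `&` wide g t.+1))%E.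
Proof.
move=> pE; pose r := Num.sqrt (\sum_i g i ^+ 2).
have g0 : 0 <= \sum_i g i ^+ 2 by apply: sumr_ge0 => i _; exact: sqr_ge0.
have [r0|r_neq0] := eqVneq r 0.
  rewrite (_ : E `&` wide g t.+1 = E).
    by rewrite -[leRHS]mul1e lee_wpmul2r// lee_fin.
  by apply/setIidl => om _; rewrite /wide/= -/r r0 mul0r.
have r_gt0 : 0 < r by rewrite lt0r r_neq0 sqrtr_ge0.
pose lam : 'cV[R]_nz := \col_i (g i / r).
have lam1 : l2_norm lam = 1.
  rewrite /l2_norm; under eq_bigr do rewrite mxE exprMn.
  by rewrite -mulr_suml exprVn sqr_sqrtr// divff ?sqrtr1// -(sqr_sqrtr g0) expf_neq0.
have := @spread lam t lam1 E pE; congr (_ <= P (_ `&` _))%E; apply/funext => om /=.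
rewrite (_ : (lam^T *m z t.+1 om) 0 0 = dot g t.+1 om / r).
  by rewrite normrM normfV (gtr0_norm r_gt0) ler_pdivlMr// mulrC.
by rewrite mxE /dot mulr_suml; apply: eq_bigr => i _; rewrite !mxE mulrAC.
Qed.

(** A union bound over net points and windows. *)
Lemma probability_not_excited (S : seq {ffun 'I_nz -> R}) (K l : nat) (B := \big[setU/set0]_(gk
    <- [seq (g, k) | g <- S, k <- iota 0 K]) no_hit (wide gk.1) (gk.2 * l) l) :
  [/\ measurable B, (P B <= (K%:R * ((size S)%:R * (1 - p) ^+ l))%:E)%E
    & forall om, ~ B om -> forall (g : {ffun 'I_nz -> R}) k, g \in S -> (k < K)%N ->
      exists2 t, (k * l < t <= k * l + l)%N &
        Num.sqrt (\sum_i g i ^+ 2) * s <= `|dot g t om|].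
Proof.
have mN (gk : {ffun 'I_nz -> R} * nat) : measurable (no_hit (wide gk.1) (gk.2 * l) l).
  apply: (measurable_no_hit past_measurable past_mono) => t; exact: past_norm_dot_ge.
split; first exact: bigsetU_measurable.
  have -> : K%:R * ((size S)%:R * (1 - p) ^+ l)
      = (size [seq (g, k) | g <- S, k <- iota 0 K])%:R * (1 - p) ^+ l.
    by rewrite size_allpairs size_iota natrM; ring.
  rewrite /B; apply: (@probability_bigsetU_le _ _ _ P _
    [seq (g, k) | g <- S, k <- iota 0 K] (fun gk => no_hit (wide gk.1) (gk.2 * l) l)
    ((1 - p) ^+ l) mN) => gk.
  apply: (probability_no_hit_le past_measurable past_mono) => //.
    by move=> t; exact: past_norm_dot_ge.
  by move=> t A; exact: spread_dot.
move=> om nB g k gS kK; apply: (@no_hitP _ _ (wide g) (k * l)%N l om) => hN; apply: nB.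
rewrite /B -bigcup_seq/=; exists (g, k) => //=.
by apply/allpairsP; exists (g, k); split => //=; rewrite mem_iota.
Qed.

Variables (q L ep wmax : R).
Hypotheses (q1 : q <= 1) (L0 : 0 < L).
Hypothesis w_indep : forall t, independent_sigma P (sigma_rv (w t)) <<s past t >>.
Hypothesis w_tails : forall t (j : 'I_nx),
  (q%:E <= P [set om | (w t om j 0 <= ep - wmax)%R])%E /\
  (q%:E <= P [set om | (wmax - ep <= w t om j 0)%R])%E.

Let big (g : 'I_nz -> R) t := [set om | L <= `|dot g t om|].
(** The sign of [dot g t] selects the end of the noise range, and the noise stays more than [ep]
    inside that end. *)
Let miss g (j : 'I_nx) t :=
  ([set om | L <= dot g t om] `&` [set om | ep - wmax < w t om j 0]) `|`
  ([set om | dot g t om <= - L] `&` [set om | w t om j 0 < wmax - ep]).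

Lemma past_miss g j t : <<s past t.+1 >> (miss g j t).
Proof.
have up A : <<s past t >> A -> <<s past t.+1 >> A.
  by apply: sub_sigma_algebra2; exact: past_mono.
apply: gen_setU; apply: gen_setI.
- by apply: up; exact: past_dot_ge.
- apply: sub_sigma_algebra; left; exists t => //.
  have := coord_event (w t) j (measurable_itv `]ep - wmax, +oo[).
  by congr coord_events; apply/funext => om /=; rewrite in_itv/= andbT.
- by apply: up; exact: past_dot_le.
- apply: sub_sigma_algebra; left; exists t => //.
  have := coord_event (w t) j (measurable_itv `]-oo, wmax - ep[).
  by congr coord_events; apply/funext => om /=; rewrite in_itv/=.
Qed.

(** Split the hit by the sign of [dot g t]. The two parts are disjoint as [L > 0], each lies in the
    past at time [t], and independence of [w t] gives each a factor [1 - q]. *)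
Lemma probability_miss_le g j t A : <<s past t >> A ->
  (P (A `&` miss g j t) <= (1 - q)%:E * P (A `&` big g t))%E.
Proof.
move=> pA; pose ev (B : set R) := [set om | B (w t om j 0)].
have tail (X : set T) (B : set R) : measurable B -> <<s past t >> X ->
    (q%:E <= P (ev B))%E ->
    (P (X `&` ev (~` B)) <= (1 - q)%:E * P X)%E.
  move=> mB pX qB.
  have -> : P (X `&` ev (~` B)) = (P (ev (~` B)) * P X)%E.
    rewrite setIC; apply: (@w_indep t) => //; apply: sub_sigma_algebra.
    by apply: coord_event; exact: measurableC.
  rewrite lee_wpmul2r//.
  have mBw : measurable (ev B).
    by apply: (coord_events_measurable (w_measurable t)); exact: coord_event.
  rewrite (_ : ev (~` B) = ~` (ev B))//.
  by rewrite probability_setC// EFinB leeB.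
pose Sp := A `&` [set om | L <= dot g t om]; pose Sm := A `&` [set om | dot g t om <= - L].
have pSp : <<s past t >> Sp by apply: gen_setI => //; exact: past_dot_ge.
have pSm : <<s past t >> Sm by apply: gen_setI => //; exact: past_dot_le.
have [t1 t2] := w_tails t j.
have h1 := @tail Sp `]-oo, ep - wmax]%classic (measurable_itv _) pSp.
have h2 := @tail Sm `[wmax - ep, +oo[%classic (measurable_itv _) pSm.
have mpast X := gen_measurable (@past_measurable X).
rewrite (_ : A `&` miss g j t = (Sp `&` ev (~` `]-oo, ep - wmax]%classic))
    `|` (Sm `&` ev (~` `[wmax - ep, +oo[%classic))); last first.
  rewrite setIUr !setIA; congr (_ `&` _ `|` _ `&` _); apply/funext => om /=.
    by rewrite /ev/= in_itv/=; apply/propext; rewrite ltNge; split => [/negP|/negP].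
  by rewrite /ev/= in_itv/= andbT; apply/propext; rewrite ltNge; split => [/negP|/negP].
rewrite (_ : A `&` big g t = Sp `|` Sm); last first.
  rewrite -setIUr; congr (_ `&` _).
  by rewrite /big; apply/seteqP; split => om /=; rewrite ler_normr lerNr => /orP.
have mt (X : set T) (B : set R) : measurable X -> measurable B ->
    measurable (X `&` ev (~` B)).
  move=> mX mB; apply: measurableI => //.
  by apply: (coord_events_measurable (w_measurable t)); apply: coord_event; exact: measurableC.
apply: le_trans (measureU2 _ (mt _ _ (mpast _ _ pSp) (measurable_itv _))
                             (mt _ _ (mpast _ _ pSm) (measurable_itv _))) _.
have disj : Sp `&` Sm = set0.
  apply/seteqP; split => // om /= [[_ Lg] [_ gL]].
  by have := le_trans Lg gL; move: L0; lra.
have -> : P (Sp `|` Sm) = (P Sp + P Sm)%E.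
  by apply: measureU => //; [exact: mpast pSp|exact: mpast pSm].
rewrite ge0_muleDr// leeD//.
  by apply: h1; move: t1; congr (_ <= P _)%E; apply/funext => om; rewrite /ev/= in_itv.
by apply: h2; move: t2; congr (_ <= P _)%E; apply/funext => om; rewrite /ev/= in_itv/= andbT.
Qed.

(** A union bound over net points and rows; each pair costs one factor [1 - q] per window. *)
Lemma probability_all_missed (S : seq {ffun 'I_nx * 'I_nz -> R}) (K l : nat)
    (B := \big[setU/set0]_(gj <- [seq (g, j) | g <- S, j <- enum 'I_nx])
       all_bad (big (fun i => gj.1 (gj.2, i))) (miss (fun i => gj.1 (gj.2, i)) gj.2) l K) :
  [/\ measurable B, (P B <= (nx%:R * ((size S)%:R * (1 - q) ^+ K))%:E)%E
    & forall om (g : {ffun 'I_nx * 'I_nz -> R}) (j : 'I_nx), g \in S ->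
      (forall k, (k < K)%N -> exists2 t, (k * l < t <= k * l + l)%N &
         L <= `|dot (fun i => g (j, i)) t om|) ->
      (forall t, (0 < t <= K * l)%N -> L <= `|dot (fun i => g (j, i)) t om| ->
        (L <= dot (fun i => g (j, i)) t om /\ ep - wmax < w t om j 0) \/
        (dot (fun i => g (j, i)) t om <= - L /\ w t om j 0 < wmax - ep)) ->
      B om].
Proof.
pose ab (gj : {ffun 'I_nx * 'I_nz -> R} * 'I_nx) :=
  all_bad (big (fun i => gj.1 (gj.2, i))) (miss (fun i => gj.1 (gj.2, i)) gj.2) l K.
have mN gj : measurable (ab gj).
  apply: (measurable_all_bad past_measurable past_mono) => t.
    exact: past_norm_dot_ge.
  exact: past_miss.
split; first by apply: bigsetU_measurable => gj _; exact: mN.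
  have -> : nx%:R * ((size S)%:R * (1 - q) ^+ K)
      = (size [seq (g, j) | g <- S, j <- enum 'I_nx])%:R * (1 - q) ^+ K.
    by rewrite size_allpairs size_enum_ord natrM; ring.
  rewrite /B; apply: (@probability_bigsetU_le _ _ _ P _
    [seq (g, j) | g <- S, j <- enum 'I_nx] ab ((1 - q) ^+ K) mN) => gj.
  apply: (probability_all_bad_le past_measurable past_mono).
  - by move=> t; exact: past_norm_dot_ge.
  - by move=> t; exact: past_miss.
  - by rewrite subr_ge0.
  - by move=> t A; exact: probability_miss_le.
move=> om g j gS hits misses; rewrite /B -bigcup_seq/=; exists (g, j) => /=.
  by apply/allpairsP; exists (g, j); rewrite mem_enum.
exact: all_badP.
Qed.

End PastEvents.

(** * Norm estimates, fitting of the windows, and assembly of the bounds *)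

Lemma frob_norm_ge0 (R : realType) (p q : nat) (A : 'M[R]_(p, q)) : 0 <= frob_norm A.
Proof. exact: sqrtr_ge0. Qed.

Lemma sqr_frob_norm (R : realType) (p q : nat) (A : 'M[R]_(p, q)) :
  frob_norm A ^+ 2 = \sum_i \sum_j A i j ^+ 2.
Proof.
by rewrite sqr_sqrtr// sumr_ge0// => i _; apply: sumr_ge0 => j _; exact: sqr_ge0.
Qed.

(** Entrywise [(a - b) ^+ 2 <= 2 * a ^+ 2 + 2 * b ^+ 2] replaces the triangle inequality and loses
    nothing when both distances are at most [c / 2]. *)
Lemma frob_norm_half (R : realType) (p q : nat) (A B C : 'M[R]_(p, q)) (c : R) :
  0 <= c -> c < frob_norm (A - B) ->
  c / 2 < frob_norm (A - C) \/ c / 2 < frob_norm (B - C).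
Proof.
move=> c0 cAB; apply/orP; apply: contraLR cAB; rewrite negb_or -!leNgt => /andP[Ac Bc].
have sq2 (D : 'M[R]_(p, q)) : frob_norm D <= c / 2 -> frob_norm D ^+ 2 <= (c / 2) ^+ 2.
  by move=> h; rewrite lerXn2r ?nnegrE ?frob_norm_ge0//; apply: divr_ge0.
rewrite -(ler_pXn2r (n := 2)) ?nnegrE ?frob_norm_ge0//.
apply: (@le_trans _ _ (2 * frob_norm (A - C) ^+ 2 + 2 * frob_norm (B - C) ^+ 2)).
  rewrite !sqr_frob_norm !mulr_sumr -big_split/=; apply: ler_sum => i _.
  rewrite !mulr_sumr -big_split/=; apply: ler_sum => j _; rewrite !mxE.
  have := sqr_ge0 ((A i j - C i j) + (B i j - C i j)); lra.
have := sq2 _ Ac; have := sq2 _ Bc; lra.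
Qed.

Lemma linf_norm_ge0 (R : realType) (n : nat) (v : 'cV[R]_n) : 0 <= linf_norm v.
Proof. exact: bigmax_ge_id. Qed.

Lemma linf_norm_ge (R : realType) (n : nat) (v : 'cV[R]_n) i : `|v i 0| <= linf_norm v.
Proof. exact: (le_bigmax _ (fun i => `|v i 0|)). Qed.

Lemma random_vector_zvec d (T : measurableType d) (R : realType) (nx nu : nat)
    (x : nat -> T -> 'cV[R]_nx) (u : nat -> T -> 'cV[R]_nu) t :
  random_vector (x t) -> random_vector (u t) -> random_vector (zvec x u t).
Proof.
move=> xm um i; rewrite /zvec; case: (split_ordP i) => j ->.
  by under eq_fun do rewrite col_mxEu; exact: xm.
by under eq_fun do rewrite col_mxEd; exact: um.
Qed.

(** If [b < s], the first coordinate of [z 1] reaches size [s] only inside the null set [N], yet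
    with probability at least [p > 0]. *)
Lemma spread_le_bound d (T : measurableType d) (R : realType) (P : probability T R)
    (nx nz : nat) (w : nat -> T -> 'cV[R]_nx) (z : nat -> T -> 'cV[R]_nz) (s p b : R)
    (N : set T) :
  (0 < nz)%N -> 0 < p -> p <= 1 -> 0 <= b ->
  (forall t, random_vector (w t)) -> (forall t, random_vector (z t)) ->
  (forall (lam : 'cV[R]_nz) (t : nat), l2_norm lam = 1 ->
     forall E, <<s past w z t >> E ->
     (p%:E * P E <= P (E `&` [set om | (s <= `|(lam^T *m z t.+1 om) 0 0|)%R]))%E) ->
  measurable N -> P N = 0 ->
  (forall om, ~ N om -> forall t, \sum_i z t om i 0 ^+ 2 <= b ^+ 2) -> s <= b.
Proof.
move=> nz0 p0 p1 b0 wm zm spread mN PN zb; rewrite leNgt; apply/negP => bs.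
pose g (i : 'I_nz) : R := (i == Ordinal nz0)%:R.
have gE (f : 'I_nz -> R) : \sum_i g i * f i = f (Ordinal nz0).
  rewrite (bigD1 (Ordinal nz0))//= /g eqxx mul1r big1 ?addr0// => i /negPf ->.
  by rewrite mul0r.
have g1 : \sum_i g i ^+ 2 = 1.
  by under eq_bigr do rewrite expr2; rewrite gE /g eqxx.
have := spread_dot p1 spread g (@gen_setT _ _ (past w z 0)).
rewrite setTI probability_setT mule1 g1 sqrtr1 mul1r.
set H := [set om | _]; have mH : measurable H.
  exact: gen_measurable (past_measurable wm zm (t := 1%N)) (@past_norm_dot_ge _ _ _ _ _ w z g s 1%N).
have : (P H <= P N)%E.
  apply: le_measure; rewrite ?inE// => om Hom; apply: contrapT => nN.
  have := norm_dot_le ler01 b0 _ (zb om nN 1%N) (u := g).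
  rewrite g1 expr1n => /(_ (lexx _)); apply/negP; rewrite -ltNge mul1r.
  exact: lt_le_trans bs Hom.
by rewrite PN => H0 /le_trans/(_ H0); rewrite lee_fin leNgt p0.
Qed.

(** Twice the total length is at most [(T.-1 %/ m) * m + m], hence below [2 * T]; this is why the
    windows have length [m./2]. *)
Lemma windows_fit (T m : nat) : (m < T)%N -> ((T.-1 %/ m).+1 * m./2 < T)%N.
Proof.
move=> mT; have l2 : (m./2.*2 <= m)%N by rewrite -[leqRHS]odd_double_half leq_addl.
have := leq_trunc_div T.-1 m; move: (T.-1 %/ m)%N => k kT.
have : (k * m./2.*2 <= k * m)%N by rewrite leq_mul2l l2 orbT.
move: l2 kT; rewrite mulSn -doubleMr; move: m./2 (k * m)%N => l km.
by move: (k * l)%N => kl; move: mT; lia.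
Qed.

Theorem theorem2 (d : measure_display) (Omega : measurableType d) (R : realType)
  (P : probability Omega R) (nx nu : nat)
  (Astar : 'M[R]_nx) (Bstar : 'M[R]_(nx, nu))
  (x : nat -> Omega -> 'cV[R]_nx) (u : nat -> Omega -> 'cV[R]_nu)
  (w : nat -> Omega -> 'cV[R]_nx)
  (wmax sigz pz bz : R) (qw : R -> R) (what : R) (m T : nat) (delta : R) :
  (* dynamics x_{t+1} = A* x_t + B* u_t + w_t = theta* z_t + w_t *)
  (forall t om, x t.+1 om = Astar *m x t om + Bstar *m u t om + w t om) ->
  (forall t, random_vector (x t)) ->
  (forall t, random_vector (u t)) ->
  (forall t, random_vector (w t)) ->
  (* Assumption A1 *)
  (forall t om, linf_norm (w t om) <= wmax) ->
  mutually_independent P (fun t => sigma_rv (w t)) ->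
  (forall t, same_law P (w t) (w 0%N)) ->
  (forall t (j : 'I_nx), ('E_P[(fun om => w t om j 0)%R] = 0)%E) ->
  posdef_mx (cov_mx P (w 0%N)) ->
  (* w_t is independent of the past F_t (causal setting) *)
  (forall t, independent_sigma P (sigma_rv (w t)) (filtration w (zvec x u) t)) ->
  (* Assumption A2 *)
  0 < sigz -> 0 < pz -> pz <= 1 ->
  (forall (lam : 'cV[R]_(nx + nu)) (t : nat), l2_norm lam = 1 ->
     forall E, filtration w (zvec x u) t E ->
     (pz%:E * P E <=
      P (E `&` [set om | (sigz <= `|(lam^T *m zvec x u t.+1 om) 0 0|)%R]))%E) ->
  (forall t, {ae P, forall om, l2_norm (zvec x u t om) <= bz}) ->
  (* Assumption A3 *)
  (forall e1 e2, 0 < e1 -> e1 <= e2 -> qw e1 <= qw e2) ->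
  (forall e, 0 < e -> 0 < qw e /\ qw e <= 1) ->
  qw (2 * wmax) = 1 ->
  (forall e t (j : 'I_nx), 0 < e ->
     ((qw e)%:E <= P [set om | (w t om j 0 <= e - wmax)%R])%E /\
     ((qw e)%:E <= P [set om | (wmax - e <= w t om j 0)%R])%E) ->
  (* the theorem *)
  wmax <= what -> (0 < m)%N -> 0 < delta -> (m < T)%N ->
  (P [set om | (delta + a5 sigz pz * Num.sqrt (nx%:R) * (what - wmax))%:E
               < diam (Theta_hat x u T what om)]
   <= (bbT1 (nx + nu) T m sigz pz bz + bbT2 nx (nx + nu) T m sigz pz bz qw delta)%:E)%E.
Proof.
move=> dyn xm um wm w_le _ _ _ _ indep s0 p0 p1 spread zb _ q_range _ tails wmax_le m0 d0 mT.
pose z := zvec x u.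
have zm t : random_vector (z t) by exact: random_vector_zvec.
have wmax0 : 0 <= wmax by apply: le_trans (w_le 0%N point); exact: linf_norm_ge0.
have what0 : 0 <= what by apply: le_trans wmax_le.
(* A single null set serves all times, as there are countably many. *)
have [N [mN PN zN]] := ae_foralln zb.
have {}zN om : ~ N om -> forall t, l2_norm (z t om) <= bz.
  by move=> nN; apply: contrapT => h; apply: nN; exact: zN.
have b0 : 0 <= bz.
  have [om nN] : exists om, ~ N om.
    apply/not_existsP => allN; have : P setT = 0.
      by rewrite (_ : setT = N)//; apply/seteqP; split => // om _; exact: contrapT.
    by rewrite probability_setT => -[] /eqP; rewrite oner_eq0.
  by apply: le_trans (zN om nN 0%N); exact: sqrtr_ge0.
have {}zN om : ~ N om -> forall t, \sum_i z t om i 0 ^+ 2 <= bz ^+ 2.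
  move=> nN t; rewrite -[leLHS]sqr_sqrtr.
    by rewrite lerXn2r ?nnegrE ?sqrtr_ge0//; exact: zN.
  by apply: sumr_ge0 => i _; exact: sqr_ge0.
have sb : (0 < nx + nu)%N -> sigz <= bz.
  by move=> nz0; exact: (@spread_le_bound _ _ _ P _ _ w z sigz pz bz N).
have a1_0 : 0 < a1 sigz pz by exact: a1_gt0.
pose c := delta + a5 sigz pz * Num.sqrt nx%:R * (what - wmax).
have c0 : 0 <= c.
  rewrite addr_ge0 ?(ltW d0)// mulr_ge0 ?subr_ge0// mulr_ge0 ?sqrtr_ge0//.
  by rewrite divr_ge0// ltW.
(* With no rows every distance is 0 and the event is empty; only nonnegativity of the bound
   remains. *)
have [nx0|nx0] := posnP nx.
  rewrite (_ : [set om | _] = set0).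
    rewrite measure0 lee_fin addr_ge0//; last first.
      by rewrite /bbT2 {1}nx0 mul0n powR0 ?mulr0 ?mul0r.
    have [nz0|nz0] := posnP (nx + nu)%N; first by rewrite /bbT1 nz0 powR0 ?mulr0 ?mul0r.
    apply: le_trans (bbT1_ge s0 p0 p1 (sb nz0) nz0 m0 mT).
    rewrite mulr_ge0// mulr_ge0 ?exprn_ge0 ?subr_ge0// mulr_ge0// addr_ge0// invr_ge0.
    by rewrite divr_ge0 ?mulr_ge0// ltW.
  apply/seteqP; split => // om /ereal_sup_gt[_ [A _ [B _ <-]]]; rewrite lte_fin.
  apply/negP; rewrite -leNgt /frob_norm big1 => [|i]; last by have := ltn_ord i; rewrite {2}nx0.
  by rewrite sqrtr0.
have nz0 : (0 < nx + nu)%N by rewrite addn_gt0 nx0.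
have {}sb := sb nz0.
have bpos : 0 < bz by exact: lt_le_trans sb.
have a1s := a1_le s0 p1.
have sq0 : 0 < Num.sqrt nx%:R :> R by rewrite sqrtr_gt0 ltr0n.
(* For [m = 1] the windows are empty and [no_hit] is certain; the factor 3 in the estimate of [bbT1]
   covers this case. *)
pose K := (T.-1 %/ m).+1; pose l := m./2.
have KlT : (K * l < T)%N by exact: windows_fit.
have e1 : 0 < sigz / (16 * bz) by rewrite divr_gt0// mulr_gt0.
have e2 : 0 < 5 / a4 nx sigz pz bz by rewrite divr_gt0//; apply: lt_le_trans (a4_ge s0 p0 p1 sb nx0).
have [S1 S1_size net1] := unit_ball_net 'I_(nx + nu) e1.
have [S2 S2_size net2] := unit_ball_net ('I_nx * 'I_(nx + nu))%type e2.
rewrite card_ord in S1_size; rewrite card_prod !card_ord in S2_size.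
(* The radius is chosen so that, against vectors of norm at most [bz], rounding costs
   [5 / 4 * a1 / sqrt nx], as in [hit_level]. *)
have e2E : 5 / a4 nx sigz pz bz = 5 * a1 sigz pz / Num.sqrt nx%:R / (4 * bz).
  by rewrite /a4; field; rewrite !lt0r_neq0.
rewrite e2E in net2.
pose ep := a1 sigz pz * delta / (4 * Num.sqrt nx%:R).
have ep0 : 0 < ep by rewrite divr_gt0// mulr_gt0.
have epE : a1 sigz pz * delta / Num.sqrt nx%:R / 4 = ep by rewrite /ep; field; rewrite lt0r_neq0.
have [q0 q1] := q_range _ ep0.
have [mB1 PB1 B1P] := probability_not_excited wm zm p1 spread S1 K l.
have L0 := hit_level_gt0 a1_0 a1s nx0.
have [mB2 PB2 B2P] := probability_all_missed wm zm q1 L0 indep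
  (fun t j => tails ep t j ep0) S2 K l.
move: mB1 PB1 B1P mB2 PB2 B2P; set B1 := \big[_/_]_(_ <- _) _; set B2 := \big[_/_]_(_ <- _) _.
move=> mB1 PB1 B1P mB2 PB2 B2P.
(* Outside the null set and the two bad events, no feasible pair is more than [c] apart. *)
apply: (@le_trans _ _ (P (N `|` (B1 `|` B2)))).
  apply: le_measure; rewrite ?inE.
  - exact: measurable_diam_Theta_hat.
  - by apply: measurableU => //; exact: measurableU.
  move=> om /ereal_sup_gt[_ [A Aw [B Bw <-]]]; rewrite lte_fin => far.
  apply: contrapT => /not_orP[nN /not_orP[nB1 nB2]].
  have [C Cw farC] : exists2 C, Theta_hat x u T what om C
      & c / 2 < frob_norm (C - row_mx Astar Bstar).
    by have [h|h] := frob_norm_half (row_mx Astar Bstar) c0 far; [exists A|exists B].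
  pose D := C - row_mx Astar Bstar.
  have residual t : (t < T)%N -> forall i, `|w t om i 0 - (D *m z t om) i 0| <= what.
    move=> tT i; have -> : w t om i 0 - (D *m z t om) i 0 = (w t om - D *m z t om) i 0.
      by rewrite [RHS]mxE [X in _ = _ + X]mxE.
    apply: le_trans (linf_norm_ge _ i) _; apply: le_trans (Cw t tT).
    rewrite dyn -mul_row_col -/(zvec x u t om) -/(z t om).
    suff -> : row_mx Astar Bstar *m z t om + w t om - C *m z t om
            = w t om - D *m z t om by [].
    by rewrite mulmxBl opprB addrCA addrA.
  (* [a5 = 4 / a1] makes half of [c] exactly the threshold of [missed_noise]. *)
  have D_large : delta / 2 + 2 * (what - wmax) / (a1 sigz pz / Num.sqrt nx%:R) < frob_norm D.
    have <- : c / 2 = delta / 2 + 2 * (what - wmax) / (a1 sigz pz / Num.sqrt nx%:R) => //.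
    by rewrite /c /a5; field; rewrite !lt0r_neq0.
  have := missed_noise s0 sb a1_0 a1s nx0 net1 net2 (zN om nN) (B1P om nB1) residual
    KlT wmax_le d0 D_large.
  move=> [g [j [gS gh gm]]]; apply: nB2; rewrite epE in gm.
  exact: B2P gm.
have mB12 : measurable (B1 `|` B2) by exact: measurableU.
have PU A B : measurable A -> measurable B -> (P (A `|` B) <= P A + P B)%E.
  by move=> mA mB; exact: measureU2.
apply: le_trans (PU _ _ mN mB12) _; rewrite PN add0e.
apply: le_trans (PU _ _ mB1 mB2) _; rewrite EFinD; apply: leeD.
  apply: le_trans PB1 _; rewrite lee_fin.
  apply: le_trans (bbT1_ge s0 p0 p1 sb nz0 m0 mT).
  by rewrite ler_wpM2l// ler_wpM2r// exprn_ge0// subr_ge0.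
apply: le_trans PB2 _; rewrite lee_fin.
apply: le_trans (bbT2_ge s0 p0 p1 sb nx0 nz0 m0 mT q1).
by rewrite ler_wpM2l// ler_wpM2r// exprn_ge0// subr_ge0.
Qed.
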